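(* Let $1\le p<\infty$, $\alpha>-1$, $\gamma,s>0$ and let $\mu$ be a positive Borel measure on $[0,1)$. The following are equivalent: (i) $\mu$ is an $s$-Carleson measure. (ii) $D_\alpha F_\mu\in H(p,\infty,\gamma)$ for any $\gamma<\alpha+1/p'$ and $s=\alpha+1/p'-\gamma$. (iii) $D_\alpha F_\mu\in A^\infty_\gamma$ for any $0<\gamma<\alpha+1$ and $s=\alpha+1-\gamma$.
   Context: $\mathbb D$ is the open unit disc of $\mathbb C$ and $\mathcal H(\mathbb D)$ is the space of analytic functions on $\mathbb D$. The exponent $p'$ is the conjugate of $p$, that is, $1/p'=1-1/p$. Positive Borel measures on $[0,1)$ are understood to be finite, so that the following objects are defined: $\mu_n=\int_0^1t^n\,d\mu(t)$ and $F_\mu(z)=\sum_{n=0}^\infty\mu_nz^n=\int_0^1\frac{d\mu(t)}{1-tz}$, $z\in\mathbb D$. For $\alpha>-1$ and $f(z)=\sum_{n\ge0}a_nz^n\in\mathcal H(\mathbb D)$, the fractional derivative is $D_\alpha f(z)=\sum_{n=0}^\infty\frac{\Gamma(n+\alpha+1)}{n!\,\Gamma(\alpha+1)}a_nz^n$. For $f\in\mathcal H(\mathbb D)$ and $0<r<1$: $M_p(f,r)=\left(\int_0^{2\pi}|f(re^{i\theta})|^p\frac{d\theta}{2\pi}\right)^{1/p}$ for $0<p<\infty$, and $M_\infty(f,r)=\max_{|z|=r}|f(z)|$. For $0<p\le\infty$ and $\gamma>0$, $H(p,\infty,\gamma)$ is the space of $f\in\mathcal H(\mathbb D)$ with $\|f\|_{(p,\infty,\gamma)}=\sup_{0<r<1}(1-r)^\gamma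 M_p(f,r)<\infty$, and $A^\infty_\gamma=H(\infty,\infty,\gamma)$, i.e. the analytic functions with $|f(z)|=O((1-|z|)^{-\gamma})$. For $s>0$, a positive Borel measure $\mu$ on $[0,1)$ is $s$-Carleson if there is $C>0$ with $\mu([r,1))\le C(1-r)^s$ for all $0<r<1$. *)

(* Defs.v *)
From HB Require Import structures.
From mathcomp Require Import all_boot all_order all_algebra complex.
From mathcomp Require Import all_classical all_reals all_analysis.

Set Implicit Arguments.
Unset Strict Implicit.
Unset Printing Implicit Defensive.

Import Order.TTheory GRing.Theory Num.Theory.
Import numFieldNormedType.Exports.

Local Open Scope classical_set_scope.
Local Open Scope complex_scope.
Local Open Scope ring_scope.

(* Only sequences and functions whose type mentions [C^o] see the topology:
   [R[i]] itself carries none, while [R[i]^o] gets the one induced by the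
   modulus of the numFieldType [R[i]]. *)

Section DiscFunctions.
Context {R : realType}.
Local Notation C := (R[i]).

Definition modulus (z : C) : R := ComplexField.Normc.normc z.

Definition cis (r theta : R) : C := (r * cos theta) +i* (r * sin theta).

Definition disc : set C := [set z | modulus z < 1].

Definition analytic_on_disc (f : C -> C) : Prop :=
  forall z : C, disc z -> derivable (f : C^o -> C^o) z 1.

Definition power_sums (a : nat -> C) (z : C) : nat -> C^o :=
  series (fun n => a n * z ^+ n : C^o).

Definition power_series (a : nat -> C) (z : C) : C :=
  lim (power_sums a z @ \oo).

Definition is_expansion (f : C -> C) (a : nat -> C) : Prop :=
  forall z : C, disc z -> power_sums a z @ \oo --> (f z : C^o).

(* The expansion of an analytic function is unique, so [xget] does select the
   Taylor coefficients. *)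
Definition coefs (f : C -> C) : nat -> C :=
  xget (fun=> 0) [set a | is_expansion f a].

Definition Gamma (x : R) : R :=
  \int[lebesgue_measure]_(t in `]0, +oo[) (t `^ (x - 1) * expR (- t)).

Definition fracD (alpha : R) (f : C -> C) : C -> C :=
  power_series (fun n =>
    (Gamma (n%:R + alpha + 1) / (n`!%:R * Gamma (alpha + 1)))%:C * coefs f n).

(* The maximum defining M_oo is written as a supremum; for [f] analytic on the
   disc it is attained, the circle being compact. The value at [-oo] is a
   dummy. *)
Definition Mean (p : \bar R) (f : C -> C) (r : R) : \bar R :=
  match p with
  | q%:E => (((2 * pi)^-1)%:E * \int[lebesgue_measure]_(theta in
      `[0%R, (2 * pi)%R]) (modulus (f (cis r theta)) `^ q)%:E) `^ q^-1
  | +oo => ereal_sup [set (modulus (f z))%:E | z in [set z | modulus z = r]]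
  | -oo => 0
  end%E.

Definition Hnorm (p : \bar R) (gamma : R) (f : C -> C) : \bar R :=
  ereal_sup [set (((1 - r) `^ gamma)%:E * Mean p f r)%E | r in `]0, 1[].

(* H(p, oo, gamma) *)
Definition Hspace (p : \bar R) (gamma : R) : set (C -> C) :=
  [set f | analytic_on_disc f /\ (Hnorm p gamma f < +oo)%E].

Definition Agrowth (gamma : R) : set (C -> C) := Hspace +oo%E gamma.

(* A finite Borel measure on [0, 1[ is represented by a finite Borel measure on
   the line that does not charge the complement of [0, 1[. *)
Definition carried_by_unit
    (mu : {finite_measure set (measurableTypeR R) -> \bar R}) : Prop :=
  mu (~` `[0, 1[) = 0%E.

Definition moment (mu : {finite_measure set (measurableTypeR R) -> \bar R})
    (n : nat) : R := \int[mu]_(t in `[0, 1[) (t ^+ n).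

Definition Fmu (mu : {finite_measure set (measurableTypeR R) -> \bar R}) :
    C -> C := power_series (fun n => (moment mu n)%:C).

Definition carleson (s : R)
    (mu : {finite_measure set (measurableTypeR R) -> \bar R}) : Prop :=
  exists2 K : R, 0 < K &
    forall r : R, 0 < r < 1 -> (mu `[r, 1%R[%classic <= (K * (1 - r) `^ s)%:E)%E.

End DiscFunctions.

(* Main.v *)
(* With [b = alpha + 1], termwise integration gives
   [D_alpha F_mu z = \int d mu(t) / (1 - t z) ^ b] on the disc.

   If [mu] is s-Carleson, then [|1 - t z| >= max (1 - t, |1 - z| / 2)] and a
   dyadic decomposition of [mu] give the single pointwise bound
   [|D_alpha F_mu z| <= K |1 - z| ^ (s - b)] for [0 < s < b]. Since
   [|1 - r e ^ (i theta)|] is comparable to [(1 - r) + |theta|] for [|theta| <= pi], this controls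
   both the maximum over the circle and, by integration in [theta], the L^p
   means, without Minkowski's inequality.

   Conversely, on an arc [0 <= theta <= e (1 - r)] the kernel has argument at most
   [1 / 2], so [|D_alpha F_mu (r e ^ (i theta))|] is at least a constant times
   [(1 - r) ^ (- b) * mu [r, 1)]; comparing with the growth of the means on that
   arc yields the Carleson condition. *)
Require Import Defs.
From mathcomp Require Import all_boot all_order all_algebra complex.
From mathcomp Require Import all_classical all_reals all_analysis.
From mathcomp Require Import measurable_realfun.
From mathcomp Require Import ring lra.

Import Order.TTheory GRing.Theory Num.Theory.
Import numFieldNormedType.Exports.
Local Open Scope classical_set_scope.
Local Open Scope ring_scope.
Set Implicit Arguments.
Unset Strict Implicit.
Unset Printing Implicit Defensive.

(** * Improper integrals and the Gamma function *)

(** [D_alpha F_mu] is given only as a power series, so termwise integration requires the sum of the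
    binomial series at [t z]. Along the segment from 0 to [z] this sum solves a linear differential
    equation in a real variable; solving it gives a polar form, with modulus [|1 - t z| ^ (- b)] and
    an argument expressed by [atan], and no branch of a complex power has to be chosen. The
    differential equation is the recursion of the binomial coefficients, hence the functional
    equation of Gamma. Since [coefs] chooses an expansion, uniqueness of expansions is needed before
    the moments can be read off [F_mu].

    The shift by [1 / p] between the two critical exponents [alpha + 1] and [alpha + 1 / p'] arises
    twice. In the upper bound, [|1 - z| ^ ((s - b) p)] has exponent [- (1 + gamma p)] and
    integration in theta gains one power before the p-th root. In the lower bound, an arc of length
    proportional to [1 - r] contributes [(1 - r) ^ (1 / p)] to the mean. *)

Section improper_FTC.
Context {R : realType}.
Notation leb := (@lebesgue_measure R).
Implicit Types (f F : R -> R).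

Lemma is_derive_continuous F (x d : R) :
  is_derive x 1 F d -> {for x, continuous F}.
Proof.
by move=> [dF _]; apply/differentiable_continuous; exact/derivable1_diffP.
Qed.

Lemma integral_is_derive f F (a b : R) : a < b ->
    (forall x : R, a <= x <= b -> is_derive x 1 F (f x)) ->
    (forall x : R, a <= x <= b -> {for x, continuous f}) ->
  (\int[leb]_(x in `[a, b]) (f x)%:E = (F b - F a)%:E)%E.
Proof.
move=> ab dF cf.
have abF (x : R) : a <= x <= b -> {for x, continuous F}.
  by move=> xab; exact: is_derive_continuous (dF _ xab).
rewrite EFinB; apply: continuous_FTC2 => //.
- apply: continuous_in_subspaceT => x; rewrite inE/= in_itv/=; exact: cf.
- split=> [x| |].
  + by rewrite in_itv/= => /andP[ax xb]; have [] := dF x; rewrite ?ltW ?ax ?xb.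
  + by apply: cvg_at_right_filter; apply: abF; rewrite lexx ltW.
  + by apply: cvg_at_left_filter; apply: abF; rewrite lexx ltW.
- move=> x; rewrite in_itv/= => /andP[ax xb].
  by rewrite derive1E; apply: derive_val; apply: dF; rewrite !ltW.
Qed.

(** Compact exhaustion of the open half line. Starting at 2 makes every interval nondegenerate, as
    [integral_is_derive] requires. *)
Let E (n : nat) : set R := `[(n.+2%:R)^-1, n.+2%:R].

Let E_lt n : (n.+2%:R)^-1 < n.+2%:R :> R.
Proof. by rewrite (@lt_trans _ _ 1)// ?invf_lt1 ?ltr1n. Qed.

Let E_gt0 n x : (n.+2%:R)^-1 <= x <= n.+2%:R -> 0 < x :> R.
Proof. by move=> /andP[+ _]; apply: lt_le_trans. Qed.

Let nndE : nondecreasing_seq E.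
Proof.
move=> m n mn; apply/subsetPset => x; rewrite /E/= !in_itv/= => /andP[xm xn].
apply/andP; split.
  by rewrite (le_trans _ xm)// lef_pV2 ?posrE// ler_nat !ltnS.
by rewrite (le_trans xn)// ler_nat !ltnS.
Qed.

Let bigcupE : \bigcup_n E n = `]0, +oo[%classic :> set R.
Proof.
apply/seteqP; split => [x [n _]|x]; rewrite /E/= !in_itv/= ?andbT.
  exact: E_gt0.
(* An index above [x + x^-1] dominates both [x] and [x^-1], which settles the two endpoints at
   once. *)
move=> x0; exists (Num.trunc (x + x^-1)) => //; rewrite /E/= in_itv/=.
have xV0 : 0 < x^-1 by rewrite invr_gt0.
have := truncnS_gt (x + x^-1); set k := Num.trunc _ => kx.
have kx2 : x + x^-1 < k.+2%:R by rewrite (lt_trans kx)// ltr_nat.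
apply/andP; split; last by lra.
by rewrite -[leRHS]invrK lef_pV2 ?posrE//; lra.
Qed.

Lemma continuous_measurable_itv0y f :
  (forall x : R, 0 < x -> {for x, continuous f}) ->
  measurable_fun (`]0, +oo[ : set R) f.
Proof.
move=> cf; apply: open_continuous_measurable_fun.
  exact: interval_open.
by move=> x; rewrite inE/= ?in_itv/= ?andbT; exact: cf.
Qed.

(** Monotone convergence along [E]. Only bounds on the primitive are assumed, no limits, because
    this serves to prove integrability. *)
Lemma integral_is_derive_bounded f F :
    (forall x : R, 0 < x -> is_derive x 1 F (f x)) ->
    (forall x : R, 0 < x -> {for x, continuous f}) ->
    (forall x : R, 0 < x -> 0 <= f x) ->
    (forall x : R, 0 < x -> 0 <= F x <= 1) ->
  (\int[leb]_(x in `]0%R, +oo[) (f x)%:E <= 1)%E.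
Proof.
move=> dF cf f0 F01.
have En n : (\int[leb]_(x in E n) (f x)%:E = (F n.+2%:R - F (n.+2%:R)^-1)%:E)%E.
  apply: integral_is_derive => // x xE; [apply: dF|apply: cf]; exact: E_gt0 xE.
have mE n : measurable (E n) by exact: measurable_itv.
have mf n : measurable_fun (E n) (EFin \o f).
  apply/measurable_EFinP; apply: measurable_funS (continuous_measurable_itv0y cf) => //.
  by rewrite -bigcupE; exact: bigcup_sup.
have f0E n x : E n x -> (0 <= (f x)%:E)%E.
  by rewrite /E/= in_itv/= => /E_gt0 x0; rewrite lee_fin f0.
have := ge0_nondecreasing_set_cvg_integral (mu := leb) nndE mE mf f0E.
rewrite bigcupE => cvgI; rewrite -(cvg_lim _ cvgI)//.
apply: lime_le; first exact: cvgP cvgI.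
apply: nearW => n; rewrite [leLHS]En lee_fin.
have /andP[_ F1] := F01 (n.+2%:R) (ltr0Sn _ _).
have /andP[F2 _] := F01 (n.+2%:R)^-1 (E_gt0 (x := (n.+2%:R)^-1) (n := n) ltac:(by rewrite lexx ltW)).
by rewrite lerBlDr (le_trans F1)// lerDl.
Qed.

(** Here [f] may change sign, so the exhaustion passes to the limit by dominated convergence, with
    [|f|] as the dominating function. *)
Lemma integral_is_derive_cvg f F (l l0 : R) :
    (forall x : R, 0 < x -> is_derive x 1 F (f x)) ->
    (forall x : R, 0 < x -> {for x, continuous f}) ->
    leb.-integrable `]0, +oo[ (EFin \o f) ->
    F x @[x --> +oo%R] --> l -> F x @[x --> 0^'+] --> l0 ->
  (\int[leb]_(x in `]0%R, +oo[) (f x)%:E = (l - l0)%:E)%E.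
Proof.
move=> dF cf intf Fl Fl0.
have En n : (\int[leb]_(x in E n) (f x)%:E = (F n.+2%:R - F (n.+2%:R)^-1)%:E)%E.
  apply: integral_is_derive => // x xE; [apply: dF|apply: cf]; exact: E_gt0 xE.
have mE n : measurable (E n) by exact: measurable_itv.
have mD : measurable (`]0, +oo[ : set R) by exact: measurable_itv.
have subE n : E n `<=` `]0, +oo[ by rewrite -bigcupE; exact: bigcup_sup.
have mf := continuous_measurable_itv0y cf.
pose g (n : nat) (x : R) := ((EFin \o f) \_ (E n)) x.
have mg n : measurable_fun (`]0, +oo[ : set R) (g n).
  have /(measurable_restrict _ (mE n) mD) : measurable_fun (`]0, +oo[ `&` E n : set R) (EFin \o f).
    by apply/measurable_EFinP; exact: (measurable_funS mD (@subIsetl _ _ _) mf).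
  exact.
have gf : {ae leb, forall x, `]0, +oo[%classic x -> g n x @[n --> \oo] --> (EFin \o f) x}.
  apply: aeW => x; rewrite -bigcupE => -[N _ ENx].
  apply: cvg_near_cst; near=> n; apply/eqP.
  rewrite /g patchE mem_set//.
  have /subsetPset EE : (E N <= E n)%O by apply: nndE; near: n; exact: nbhs_infty_ge.
exact: EE.
have gle : {ae leb, forall x n, `]0, +oo[%classic x -> (`|g n x| <= (abse \o (EFin \o f)) x)%E}.
  apply: aeW => x n _; rewrite /g patchE/=; case: ifPn => // _.
  by rewrite abse0.
have mEf : measurable_fun (`]0, +oo[ : set R) (EFin \o f) by exact/measurable_EFinP.
have [_ _] := dominated_convergence (mu := leb) mD mg mEf gf (integrable_abse intf) gle.
have -> : (fun n => \int[leb]_(x in `]0%R, +oo[) g n x)%E =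
          (fun n => (F n.+2%:R - F (n.+2%:R)^-1)%:E).
  apply/funext => n; rewrite -En /g.
  rewrite -integral_mkcondr setIidr//.
move=> /cvg_lim => <-//.
apply/cvg_lim => //; apply: cvg_EFin; first exact: nearW.
have natSS : (n.+2%:R : R) @[n --> \oo] --> +oo.
  apply/cvgryPge => M; near=> n.
  apply: (@le_trans _ _ n%:R); last by rewrite ler_nat -addn2 leq_addr.
  by near: n; exact: nbhs_infty_ger.
apply: cvgB.
  apply: cvg_comp; [exact: natSS|exact: Fl].
move/cvg_at_rightP : Fl0; apply; split=> [n|]; first by rewrite invr_gt0.
apply/cvgrVy; first by apply: nearW => n; rewrite invr_gt0.
by apply: cvg_trans natSS; apply: near_eq_cvg; apply: nearW => n; rewrite /= invrK.
Unshelve. all: end_near. Qed.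
End improper_FTC.

Section Gamma_function.
Context {R : realType}.
Notation leb := (@lebesgue_measure R).

Lemma is_derive_congr (f g : R -> R) (x d e : R) :
  is_derive x 1 f d -> f =1 g -> d = e -> is_derive x 1 g e.
Proof. by move=> df /funext <- <-. Qed.

Lemma is_derive_powR_comp (u : R -> R) (a x du : R) : 0 < u x ->
  is_derive x 1 u du ->
  is_derive x 1 (fun t => u t `^ a) (a * u x `^ (a - 1) * du).
Proof.
move=> ux0 dux.
exact: (@is_derive1_comp R (fun y => y `^ a) u x _ _ (is_derive1_powR a ux0) dux).
Qed.

Lemma powR_continuous (a x : R) : 0 < x -> {for x, continuous (fun t => t `^ a)}.
Proof. by move=> x0; exact: is_derive_continuous (is_derive1_powR a x0). Qed.

Lemma expRN_continuous (x : R) : {for x, continuous (fun t => expR (- t))}.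
Proof.
by apply: continuous_comp; [exact: continuousN|exact: continuous_expR].
Qed.

(** Raise [u / y <= expR (u / y)] to the power [y]. *)
Lemma powR_le_expR (y u : R) : 0 < y -> 0 < u -> u `^ y <= y `^ y * expR u.
Proof.
move=> y0 u0.
have uy : u / y <= expR (u / y) by rewrite (le_trans _ (expR_ge1Dx _))// lerDr.
have uy0 : 0 <= u / y by rewrite divr_ge0 ?ltW.
have /(ge0_ler_powR (ltW y0)) : u / y <= expR (u / y) by [].
rewrite !nnegrE expR_ge0 => /(_ uy0 isT).
rewrite -expRM divfK ?gt_eqF// => h.
rewrite -[in leLHS](divfK (lt0r_neq0 y0) u) powRM ?(ltW y0)// mulrC.
by rewrite ler_wpM2l// powR_ge0.
Qed.

Definition gamma_integrand (x t : R) : R := t `^ (x - 1) * expR (- t).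

Lemma gamma_integrand_continuous (x t : R) : 0 < t ->
  {for t, continuous (gamma_integrand x)}.
Proof.
move=> t0; apply: continuousM; first exact: powR_continuous.
exact: expRN_continuous.
Qed.

Lemma gamma_integrand_ge0 (x t : R) : 0 <= gamma_integrand x t.
Proof. by rewrite mulr_ge0 ?powR_ge0 ?expR_ge0. Qed.

(* The integrand is dominated by the derivative of [(t / (1 + t)) `^ x]. *)
Lemma integrable_gamma_integrand (x : R) : 0 < x ->
  leb.-integrable `]0, +oo[ (EFin \o gamma_integrand x).
Proof.
move=> x0.
have mg : measurable_fun (`]0, +oo[%classic : set R) (gamma_integrand x).
  apply: continuous_measurable_itv0y; exact: gamma_integrand_continuous.
pose u (t : R) := t / (1 + t).
pose f (t : R) := x * (u t) `^ (x - 1) * (1 + t) ^- 2.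
have t1 (t : R) : 0 < t -> 0 < 1 + t by move=> t0; rewrite addr_gt0.
have u0 (t : R) : 0 < t -> 0 < u t by move=> t0; rewrite divr_gt0 ?t1.
have du (t : R) : 0 < t -> is_derive t 1 u ((1 + t) ^- 2).
  move=> t0; have t10 : 1 + t != 0 by rewrite gt_eqF ?t1.
  have d1 : is_derive t 1 (fun y : R => 1 + y) (0 + 1).
    exact: is_deriveD (is_derive_cst (1 : R) t 1) (is_derive_id t (1 : R)).
  have dV := is_deriveV t10 d1.
  apply: is_derive_congr (is_deriveM (is_derive_id t (1 : R)) dV) _ _ => //.
  by rewrite /GRing.scale/=; field.
have df (t : R) : 0 < t -> is_derive t 1 (fun t => u t `^ x) (f t).
  by move=> t0; exact: is_derive_powR_comp (u0 _ t0) (du _ t0).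
have cf (t : R) : 0 < t -> {for t, continuous f}.
  move=> t0; apply: continuousM.
    apply: continuousM; first exact: cst_continuous.
    apply: (@continuous_comp _ _ _ u (fun y => y `^ (x - 1))).
      exact: is_derive_continuous (du _ t0).
    exact: powR_continuous (u0 _ t0).
  apply: continuousV; first by rewrite expf_neq0// gt_eqF ?t1.
  apply: (@continuous_comp _ _ _ (fun y : R => 1 + y) (fun y => y ^+ 2)); last exact: exprn_continuous.
  by apply: continuousD; [exact: cst_continuous|exact: cvg_id].
have f0 (t : R) : 0 < t -> 0 <= f t.
  move=> t0; rewrite mulr_ge0//; first by rewrite mulr_ge0 ?powR_ge0 ?ltW.
  by rewrite invr_ge0 exprn_ge0 ?ltW ?t1.
have F01 (t : R) : 0 < t -> 0 <= u t `^ x <= 1.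
  move=> t0; rewrite powR_ge0/=.
  have -> : (1 : R) = 1 `^ x by rewrite powR1.
  rewrite ge0_ler_powR ?nnegrE ?(ltW x0) ?(ltW (u0 _ t0))//.
  by rewrite ler_pdivrMr ?t1// mul1r lerDr.
have int1 := integral_is_derive_bounded df cf f0 F01.
have x10 : 0 < x + 1 by rewrite addr_gt0.
(* [f t] equals [x * t ^ (x - 1) * (1 + t) ^ (- (x + 1))], and [powR_le_expR] at [1 + t] with
   exponent [x + 1] bounds [expR (- t)] by [(x + 1) ^ (x + 1) * e * (1 + t) ^ (- (x + 1))]. *)
pose C := (x + 1) `^ (x + 1) * expR 1 / x.
have C0 : 0 <= C by rewrite divr_ge0 ?(ltW x0)// mulr_ge0 ?powR_ge0 ?expR_ge0.
have gf (t : R) : 0 < t -> gamma_integrand x t <= C * f t.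
  move=> t0.
  have -> : C * f t = t `^ (x - 1) * ((x + 1) `^ (x + 1) * expR 1 * (1 + t) `^ (- (x + 1))).
    rewrite /C /f /u powRM ?invr_ge0 ?ltW ?t1//.
    rewrite -[(1 + t)^-1]powR_inv1 ?ltW ?t1// -powRrM.
    rewrite -[(1 + t) ^- 2]powR_invn ?ltW ?t1//.
    have -> : - (x + 1) = -1 * (x - 1) + - 2%:R by ring.
    rewrite [in RHS](@powRD _ (1 + t)); last by rewrite (gt_eqF (t1 _ t0)) implybT.
    by field; rewrite gt_eqF.
  rewrite ler_wpM2l ?powR_ge0// powRN.
  rewrite ler_pdivlMr ?powR_gt0 ?t1//.
  rewrite mulrC; apply: le_trans (_ : (x + 1) `^ (x + 1) * expR (1 + t) * expR (- t) <= _).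
    by rewrite ler_wpM2r ?expR_ge0// powR_le_expR ?t1.
  by rewrite -mulrA -expRD addrK.
have mf : measurable_fun (`]0, +oo[%classic : set R) f by exact: continuous_measurable_itv0y.
apply/integrableP; split; first exact/measurable_EFinP.
apply: (@le_lt_trans _ _ (\int[leb]_(t in `]0%R, +oo[) (C%:E * (f t)%:E))%E).
  apply: ge0_le_integral => //.
  - by apply: measurableT_comp => //; exact/measurable_EFinP.
  - by apply: measurable_funeM; exact/measurable_EFinP.
  - move=> t; rewrite /= in_itv/= andbT => t0.
    by rewrite -EFinM lee_fin ger0_norm ?gamma_integrand_ge0// gf.
rewrite ge0_integralZl//; first last.
- by move=> t; rewrite /= in_itv/= andbT => t0; rewrite lee_fin f0.
- exact/measurable_EFinP.
apply: (@le_lt_trans _ _ (C%:E * 1)%E); first by rewrite lee_wpmul2l// lee_fin.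
by rewrite mule1 ltry.
Qed.

Lemma GammaE (x : R) : 0 < x ->
  (\int[leb]_(t in `]0%R, +oo[) (gamma_integrand x t)%:E = (Gamma x)%:E)%E.
Proof.
move=> x0; rewrite /Gamma /Rintegral fineK//.
exact: integrable_fin_num (integrable_gamma_integrand x0).
Qed.

Lemma Gamma_gt0 (x : R) : 0 < x -> 0 < Gamma x.
Proof.
move=> x0; rewrite -lte_fin -GammaE//.
(* A lower bound of the integrand on [[1, 2]]; the minimum covers both signs of [x - 1]. *)
pose m := Num.min (1 `^ (x - 1) : R) (2 `^ (x - 1)) * expR (- 2).
have m0 : 0 < m by rewrite mulr_gt0 ?expR_gt0// lt_min !powR_gt0.
have gm (t : R) : 1 <= t <= 2 -> m <= gamma_integrand x t.
  move=> /andP[t1 t2]; have t0 : 0 < t by rewrite (lt_le_trans _ t1).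
  rewrite /m /gamma_integrand; apply: ler_pM.
  - by rewrite le_min !powR_ge0.
  - exact: expR_ge0.
  - have [xx|xx] := leP 0 (x - 1).
      by rewrite ge_min ge0_ler_powR ?nnegrE// ltW.
    rewrite ge_min; apply/orP; right.
    rewrite -(opprK (x - 1)) powRN [leRHS]powRN lef_pV2 ?posrE ?powR_gt0//.
    by rewrite ge0_ler_powR ?nnegrE ?oppr_ge0 ?(ltW xx) ?(ltW t0).
  - by rewrite ler_expR lerN2.
have mg : measurable_fun (`]0, +oo[%classic : set (measurableTypeR R)) (EFin \o gamma_integrand x).
  apply/measurable_EFinP; apply: continuous_measurable_itv0y; exact: gamma_integrand_continuous.
have sub : (`[1, 2]%classic : set R) `<=` `]0, +oo[%classic.
  by move=> t; rewrite /= !in_itv/= andbT => /andP[t1 _]; rewrite (lt_le_trans _ t1).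
apply: (@lt_le_trans _ _ (\int[leb]_(t in `[1%R, 2%R]) (gamma_integrand x t)%:E)%E).
  apply: (@lt_le_trans _ _ (\int[leb]_(t in `[1%R, 2%R]) m%:E)%E).
    rewrite integral_cst//= lebesgue_measure_itv/= lte_fin ltr1n/=.
    by rewrite -EFinB -EFinM lte_fin mulr_gt0// subr_gt0 ltr1n.
  apply: ge0_le_integral => //.
  - by move=> t _; rewrite lee_fin ltW.
  - by apply: measurable_funS mg => //; exact: measurable_itv.
apply: ge0_subset_integral; [exact: measurable_itv|exact: measurable_itv|exact: mg| |exact: sub].
by move=> t _; rewrite /= lee_fin gamma_integrand_ge0.
Qed.

(** Integration by parts: [t ^ x * expR (- t)] tends to 0 at both ends, and its derivative is the
    difference of the two integrands. *)
Lemma GammaS (x : R) : 0 < x -> Gamma (x + 1) = x * Gamma x.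
Proof.
move=> x0; have x10 : 0 < x + 1 by rewrite addr_gt0.
pose F (t : R) := t `^ x * expR (- t).
pose f (t : R) := x * gamma_integrand x t - gamma_integrand (x + 1) t.
have df (t : R) : 0 < t -> is_derive t 1 F (f t).
  move=> t0; apply: is_derive_congr (is_deriveM (is_derive1_powR x t0)
    (is_derive1_comp (f := expR) (is_derive_expR (- t)) (is_deriveNid t (1 : R)))) _ _ => //.
  rewrite /f /gamma_integrand addrK /GRing.scale/=; ring.
have ix := integrable_gamma_integrand x0.
have ix1 := integrable_gamma_integrand x10.
have mD : measurable (`]0, +oo[%classic : set (measurableTypeR R)) by exact: measurable_itv.
have ixx : leb.-integrable `]0, +oo[ (EFin \o (fun t => x * gamma_integrand x t)).
  exact: (integrableZl mD x ix).
have cf (t : R) : 0 < t -> {for t, continuous f}.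
  move=> t0; apply: continuousB; last exact: gamma_integrand_continuous.
  by apply: continuousM; [exact: cst_continuous|exact: gamma_integrand_continuous].
have intf : leb.-integrable `]0, +oo[ (EFin \o f).
  exact: (integrableB mD ixx ix1).
have Fl : F t @[t --> +oo%R] --> (0 : R).
  pose C := (x + 1) `^ (x + 1).
  have C0 : 0 < C by rewrite powR_gt0.
  apply: (@squeeze_cvgr _ _ _ _ (fun=> 0) (fun t : R => C * t^-1)).
  - near=> t; have t0 : 0 < t by near: t; exact: nbhs_pinfty_gt.
    rewrite /F mulr_ge0 ?powR_ge0 ?expR_ge0//=.
    rewrite ler_pdivlMr// mulrAC -{2}(powRr1 (ltW t0)) -powRD; last by rewrite (gt_eqF t0) implybT.
    by rewrite expRN ler_pdivrMr ?expR_gt0// powR_le_expR.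
  - exact: cvg_cst.
  - rewrite -[X in _ --> X](mulr0 C); apply: cvgM; first exact: cvg_cst.
    by apply/(@gtr0_cvgV0 _ _ _ _ id); [exact: nbhs_pinfty_gt|exact: cvg_id].
have Fl0 : F t @[t --> 0^'+] --> (0 : R).
  apply: (@squeeze_cvgr _ _ _ _ (fun=> 0) (fun t : R => t `^ x)).
  - near=> t; have t0 : 0 < t by [].
    rewrite /F mulr_ge0 ?powR_ge0 ?expR_ge0//=.
    by rewrite ler_piMr ?powR_ge0// -expR0 ler_expR oppr_le0 ltW.
  - exact: cvg_cst.
  - exact: powR_cvg0.
have := integral_is_derive_cvg df cf intf Fl Fl0.
have -> : (\int[leb]_(t in `]0%R, +oo[) (f t)%:E = (x * Gamma x - Gamma (x + 1))%:E)%E.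
  rewrite (integralB_EFin mD ixx ix1) EFinB GammaE//; congr (_ - _)%E.
  under eq_integral do rewrite EFinM.
  by rewrite integralZl// GammaE.
by rewrite subr0 => -[/eqP]; rewrite subr_eq0 => /eqP.
Unshelve. all: by end_near. Qed.

End Gamma_function.

(** * Power series and the binomial series *)

Section coefficient_growth.
Context {R : realType}.
Implicit Types (a : nat -> R) (q x : R).

(** Radius of convergence at least 1, in Abel's form: bounded terms are easier to verify than
    summable ones, and give absolute convergence at every smaller radius. *)
Definition radius_ge1 a :=
  forall q, 0 < q < 1 -> exists M, forall n, `|a n| * q ^+ n <= M.

(** Each of the [n] terms of [1 + q + ... + q ^+ (n - 1)] is at least [q ^+ n]; multiply by [1 - q].
    This absorbs the factor produced by differentiating a power series. *)
Lemma natr_expr_le q n : 0 <= q < 1 -> n%:R * (1 - q) * q ^+ n <= 1 - q ^+ n.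
Proof.
move=> /andP[q0 q1]; elim: n => [|n IH]; first by rewrite expr0 subrr !mul0r.
have qn1 : q ^+ n.+1 <= 1 by rewrite exprn_ile1// ltW.
have qn0 : 0 <= q ^+ n.+1 by rewrite exprn_ge0.
have -> : n.+1%:R * (1 - q) * q ^+ n.+1 =
          q * (n%:R * (1 - q) * q ^+ n) + (1 - q) * q ^+ n.+1.
  by rewrite -natr1 exprS; ring.
have := ler_wpM2l q0 IH; rewrite [leRHS]mulrBr mulr1 -exprS => h.
have : (1 - q) * q ^+ n.+1 <= 1 - q by rewrite ler_piMr// subr_ge0 ltW.
by lra.
Qed.

Lemma radius_ge1_diffs a : radius_ge1 a -> radius_ge1 (pseries_diffs a).
Proof.
move=> ra q /andP[q0 q1].
(* The terms are bounded at the larger radius [r]; the decay of [(q / r) ^+ n.+1] then pays for the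
   factor [n.+1]. *)
pose r := (1 + q) / 2; have qr : q < r by rewrite /r; lra.
have r0 : 0 < r by rewrite (lt_trans q0).
have r1 : r < 1 by rewrite /r; lra.
have [M aM] : exists M, forall n, `|a n| * r ^+ n <= M by apply: ra; rewrite r0.
have M0 : 0 <= M by rewrite (le_trans _ (aM 0%N))// mulr_ge0// exprn_ge0// ltW.
pose t := q / r; have t0 : 0 < t by rewrite divr_gt0.
have t1 : t < 1 by rewrite ltr_pdivrMr// mul1r.
exists (M / (q * (1 - t))) => n.
rewrite ler_pdivlMr; last by rewrite mulr_gt0// subr_gt0.
rewrite /pseries_diffs normrM normr_nat.
have -> : n.+1%:R * `|a n.+1| * q ^+ n * (q * (1 - t)) =
   (n.+1%:R * (1 - t) * t ^+ n.+1) * (`|a n.+1| * r ^+ n.+1).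
  have E : q ^+ n * q = t ^+ n.+1 * r ^+ n.+1.
    by rewrite -exprSr -exprMn /t divfK// gt_eqF.
  transitivity (n.+1%:R * (1 - t) * `|a n.+1| * (q ^+ n * q)); first by ring.
  by rewrite E; ring.
rewrite -[leRHS]mul1r; apply: ler_pM => //.
- by rewrite !mulr_ge0 ?exprn_ge0 ?(ltW t0)// subr_ge0 ltW.
- by rewrite mulr_ge0 ?exprn_ge0 ?(ltW r0).
- apply: le_trans (natr_expr_le n.+1 _) _; first by rewrite (ltW t0).
  by rewrite gerBl exprn_ge0// ltW.
Qed.

Lemma radius_ge1M a (b : nat -> R) (B : R) : (forall n, `|b n| <= B) ->
  radius_ge1 a -> radius_ge1 (fun n => a n * b n).
Proof.
move=> bB ra q q01; have [M aM] := ra q q01; exists (M * B) => n.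
rewrite normrM mulrAC; apply: ler_pM => //.
by rewrite mulr_ge0// exprn_ge0//; case/andP: q01 => /ltW.
Qed.

Lemma radius_ge1_cvg_norm a x : radius_ge1 a -> 0 <= x < 1 ->
  cvgn (series (fun n => `|a n| * x ^+ n)).
Proof.
move=> ra /andP[x0 x1].
pose r := (1 + x) / 2; have xr : x < r by rewrite /r; lra.
have r0 : 0 < r by rewrite (le_lt_trans x0).
have r1 : r < 1 by rewrite /r; lra.
have [M aM] : exists M, forall n, `|a n| * r ^+ n <= M by apply: ra; rewrite r0.
have M0 : 0 <= M by rewrite (le_trans _ (aM 0%N))// mulr_ge0// exprn_ge0// ltW.
apply: (@series_le_cvg _ _ (geometric M (x / r))).
- by move=> n; rewrite mulr_ge0// exprn_ge0.
- by move=> n; rewrite /geometric/= mulr_ge0// exprn_ge0// divr_ge0// ltW.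
- move=> n; rewrite /geometric/= expr_div_n mulrA ler_pdivlMr ?exprn_gt0//.
  by rewrite mulrAC ler_wpM2r ?exprn_ge0.
- apply: is_cvg_geometric_series; rewrite ger0_norm ?divr_ge0 ?(ltW r0)//.
  by rewrite ltr_pdivrMr// mul1r.
lra.
Qed.

(** The weights [w] stand for real or imaginary parts of powers of a complex number, so that two
    real series replace one complex series. *)
Lemma radius_ge1_cvg a (w : nat -> R) x : radius_ge1 a -> 0 <= x < 1 ->
  (forall n, `|w n| <= x ^+ n) -> cvgn (series (fun n => a n * w n)).
Proof.
move=> ra x01 wx; apply: normed_cvg; rewrite /normed_series_of.
apply: (@series_le_cvg _ _ (fun n => `|a n| * x ^+ n)).
- by move=> n; exact: normr_ge0.
- by move=> n; rewrite mulr_ge0// exprn_ge0//; case/andP: x01.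
- by move=> n; rewrite /= normrM ler_wpM2l.
- exact: radius_ge1_cvg_norm.
Qed.

End coefficient_growth.

(** * Coefficients of the negative binomial series *)

Section negative_binomial_coefficients.
Context {R : realType}.
Variable b : R.
Hypothesis b0 : 0 < b.

(* Taylor coefficients of [(1 - w) ^ (- b)]. *)
Definition negbin (n : nat) : R := Gamma (n%:R + b) / (n`!%:R * Gamma b).

Lemma negbin0 : negbin 0 = 1.
Proof. by rewrite /negbin add0r fact0 mul1r divff// gt_eqF ?Gamma_gt0. Qed.

(** Coefficient form of [(1 - w) H' = b H]; the functional equation of [Gamma] enters only here. *)
Lemma negbinS n : n.+1%:R * negbin n.+1 = (n%:R + b) * negbin n.
Proof.
have nb : 0 < n%:R + b by rewrite ltr_wpDl.
rewrite /negbin -natr1 addrAC GammaS// factS natrM -natr1.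
have n0 : n`!%:R != 0 :> R by rewrite pnatr_eq0 -lt0n fact_gt0.
have n1 : n%:R + 1 != 0 :> R by rewrite natr1 pnatr_eq0.
by field; rewrite n0 n1 gt_eqF ?Gamma_gt0.
Qed.

Lemma negbin_gt0 n : 0 < negbin n.
Proof.
elim: n => [|n IH]; first by rewrite negbin0.
by rewrite -(pmulr_rgt0 _ (ltr0Sn R n)) negbinS mulr_gt0// ltr_wpDl.
Qed.

(** The ratio of successive terms is [(n + b) q / (n + 1)], below 1 once [n > b q / (1 - q)]. The
    terms decrease from [N] on, and the sum of those up to [N] bounds them all. *)
Lemma negbin_radius : radius_ge1 negbin.
Proof.
move=> q /andP[q0 q1].
pose d n := negbin n * q ^+ n.
have d0 n : 0 <= d n by rewrite mulr_ge0 ?exprn_ge0 ?ltW// negbin_gt0.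
pose N := (Num.trunc (b * q / (1 - q))).+1.
have dS n : (N <= n)%N -> d n.+1 <= d n.
  move=> Nn; rewrite -(ler_pM2l (ltr0Sn R n)) /d mulrA negbinS exprS.
  have -> : (n%:R + b) * negbin n * (q * q ^+ n) = ((n%:R + b) * q) * (d n) by rewrite /d; ring.
  apply: ler_wpM2r => //.
  have : b * q / (1 - q) < n%:R.
    by apply: lt_le_trans (truncnS_gt _) _; rewrite ler_nat.
  rewrite ltr_pdivrMr ?subr_gt0// => h; rewrite -natr1.
  by rewrite mulrDl; move: h; rewrite mulrBr mulr1; lra.
exists (\sum_(k < N.+1) d k) => n; rewrite (gtr0_norm (negbin_gt0 n)) -/(d n).
have [nN|Nn] := leqP n N.
  have nN' : (n < N.+1)%N by [].
  rewrite (bigD1 (Ordinal nN'))//= lerDl sumr_ge0//.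
apply: (@le_trans _ _ (d N)); last first.
  by rewrite (bigD1 ord_max)//= lerDl sumr_ge0.
rewrite -(subnK (ltnW Nn)); elim: (n - N)%N => [//|k IH].
by rewrite addSn; apply: le_trans IH; apply: dS; rewrite leq_addl.
Qed.

End negative_binomial_coefficients.

(** * Complex power series with real coefficients *)

Section complex_series.
Context {R : realType}.
Local Notation C := (R[i]).
Local Notation Re := (@complex.Re R).
Local Notation Im := (@complex.Im R).
Implicit Types (z w : C) (a : nat -> R).

Lemma modulusE z : modulus z = Num.sqrt (Re z ^+ 2 + Im z ^+ 2).
Proof. by case: z. Qed.

Lemma modulus_ge0 z : 0 <= modulus z.
Proof. by rewrite modulusE sqrtr_ge0. Qed.

Lemma normC_modulus z : `|z| = (modulus z)%:C%C.
Proof. by rewrite normc_def modulusE. Qed.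

Lemma modulusM z w : modulus (z * w) = modulus z * modulus w.
Proof. exact: ComplexField.Normc.normcM. Qed.

Lemma modulusX z n : modulus (z ^+ n) = modulus z ^+ n.
Proof.
elim: n => [|n IH]; last by rewrite !exprS modulusM IH.
by rewrite !expr0; exact: ComplexField.Normc.normc1.
Qed.

Lemma modulusV z : modulus z^-1 = (modulus z)^-1.
Proof. exact: ComplexField.Normc.normcV. Qed.

Lemma modulusN z : modulus (- z) = modulus z.
Proof. exact: normcN. Qed.

Lemma modulusD z w : modulus (z + w) <= modulus z + modulus w.
Proof. exact: le_normcD. Qed.

Lemma modulus_real (x : R) : modulus x%:C%C = `|x|.
Proof. by rewrite modulusE/= expr0n addr0 sqrtr_sqr. Qed.

Lemma modulus_eq0 z : (modulus z == 0) = (z == 0).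
Proof.
apply/eqP/eqP => [|->]; first exact: ComplexField.Normc.eq0_normc.
exact: ComplexField.Normc.normc0.
Qed.

Lemma modulus0 : modulus 0 = 0 :> R.
Proof. by apply/eqP; rewrite modulus_eq0. Qed.

Lemma modulus1 : modulus (1 : C) = 1.
Proof. exact: ComplexField.Normc.normc1. Qed.

Lemma modulus_natr n : modulus (n%:R : C) = n%:R.
Proof. by rewrite -(rmorph_nat (real_complex R)) modulus_real normr_nat. Qed.

Lemma discE z : disc z = (modulus z < 1) :> Prop.
Proof. by []. Qed.

Lemma Re_le_modulus z : `|Re z| <= modulus z.
Proof. by rewrite -lecR -normC_modulus normc_ge_Re. Qed.

Lemma Im_le_modulus z : `|Im z| <= modulus z.
Proof.
by rewrite modulusE -sqrtr_sqr ler_wsqrtr// lerDr sqr_ge0.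
Qed.

Lemma modulus_le_ReIm z : modulus z <= `|Re z| + `|Im z|.
Proof.
rewrite {1}(complexE z); apply: le_trans (modulusD _ _) _.
rewrite modulusM !modulus_real lerD2l.
by rewrite modulusE/= expr0n/= expr1n add0r sqrtr1 mul1r.
Qed.

(** The radius [e] of a ball in [C^o] is itself a complex number; [0 < e] forces a zero imaginary
    part, which makes it interchangeable with a real radius. *)
Lemma cvgC_modulus (u : nat -> C^o) (l : C^o) :
  (modulus (u n - l) @[n --> \oo] --> (0 : R)) <-> u @ \oo --> l.
Proof.
split=> [/cvgrPdist_lt ul|/cvgrPdist_lt ul].
  apply/cvgrPdist_lt => e; rewrite ltcE/= => /andP[/eqP Ie Re0].
  have := ul _ Re0; apply: filterS => n.
  rewrite sub0r normrN ger0_norm ?modulus_ge0// => h.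
  by rewrite distrC normC_modulus ltcE/= -Ie eqxx.
apply/cvgrPdist_lt => e e0.
have e0' : (0 : C) < e%:C%C by rewrite ltcR.
have := ul _ e0'; apply: filterS => n.
by rewrite distrC normC_modulus ltcR sub0r normrN ger0_norm ?modulus_ge0.
Qed.

Lemma cvgC_ReIm (u : nat -> C) (x y : R) :
  Re (u n) @[n --> \oo] --> x -> Im (u n) @[n --> \oo] --> y ->
  (u : nat -> C^o) @ \oo --> ((x +i* y)%C : C^o).
Proof.
move=> ux uy; apply/cvgC_modulus.
apply: (@squeeze_cvgr _ _ _ _ (fun=> 0) (fun n => `|Re (u n) - x| + `|Im (u n) - y|)).
- apply: nearW => n; rewrite modulus_ge0/= (le_trans (modulus_le_ReIm _))//.
  by case: (u n).
- exact: cvg_cst.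
- have cvg_dist (v : nat -> R) (k : R) : v n @[n --> \oo] --> k ->
      `|v n - k| @[n --> \oo] --> 0.
    move=> vk; rewrite -[X in _ --> X](normr0 R) -(subrr k).
    by apply: cvg_norm; apply: cvgB => //; exact: cvg_cst.
  by rewrite -[X in _ --> X](addr0 0); apply: cvgD; exact: cvg_dist.
Qed.

Lemma ReZ (x : R) z : Re (x%:C%C * z) = x * Re z.
Proof. by case: z => u v /=; rewrite mul0r subr0. Qed.

Lemma ImZ (x : R) z : Im (x%:C%C * z) = x * Im z.
Proof. by case: z => u v /=; rewrite mul0r addr0. Qed.

Lemma Re_sum n (F : nat -> C) : Re (\sum_(0 <= k < n) F k) = \sum_(0 <= k < n) Re (F k).
Proof.
elim: n => [|n IH]; first by rewrite !big_nil.
by rewrite !big_nat_recr//= -IH; case: (\sum_(0 <= i < n) F i); case: (F n).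
Qed.

Lemma Im_sum n (F : nat -> C) : Im (\sum_(0 <= k < n) F k) = \sum_(0 <= k < n) Im (F k).
Proof.
elim: n => [|n IH]; first by rewrite !big_nil.
by rewrite !big_nat_recr//= -IH; case: (\sum_(0 <= i < n) F i); case: (F n).
Qed.

Lemma ReX_le z n : `|Re (z ^+ n)| <= modulus z ^+ n.
Proof. by rewrite -modulusX Re_le_modulus. Qed.

Lemma ImX_le z n : `|Im (z ^+ n)| <= modulus z ^+ n.
Proof. by rewrite -modulusX Im_le_modulus. Qed.

Lemma power_sums_cvg a z : radius_ge1 a -> disc z ->
  power_sums (fun n => (a n)%:C%C) z @ \oo -->
  ((limn (series (fun n => a n * Re (z ^+ n)))
    +i* limn (series (fun n => a n * Im (z ^+ n))))%C : C^o).
Proof.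
move=> ra z1; have z01 : 0 <= modulus z < 1 by rewrite modulus_ge0.
apply: cvgC_ReIm.
- have -> : (fun n => Re (power_sums (fun n => (a n)%:C%C) z n)) =
            series (fun n => a n * Re (z ^+ n)).
    apply/funext => n; rewrite /power_sums /series/= Re_sum.
    by apply: eq_bigr => k _; rewrite ReZ.
  exact: radius_ge1_cvg ra z01 (ReX_le z).
- have -> : (fun n => Im (power_sums (fun n => (a n)%:C%C) z n)) =
            series (fun n => a n * Im (z ^+ n)).
    apply/funext => n; rewrite /power_sums /series/= Im_sum.
    by apply: eq_bigr => k _; rewrite ImZ.
  exact: radius_ge1_cvg ra z01 (ImX_le z).
Qed.

Lemma power_seriesE a z : radius_ge1 a -> disc z ->
  power_series (fun n => (a n)%:C%C) z =
  (limn (series (fun n => a n * Re (z ^+ n)))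
    +i* limn (series (fun n => a n * Im (z ^+ n))))%C.
Proof.
move=> ra z1.
exact: (cvg_lim (@norm_hausdorff _ (C^o)) (power_sums_cvg ra z1)).
Qed.

Lemma power_series_expansion a : radius_ge1 a ->
  is_expansion (power_series (fun n => (a n)%:C%C)) (fun n => (a n)%:C%C).
Proof. by move=> ra z z1; rewrite power_seriesE//; exact: power_sums_cvg. Qed.

End complex_series.

(** * Differentiation along a ray *)

Section weighted_series.
Context {R : realType}.
Implicit Types (a w : nat -> R) (r x : R).

Lemma pseries_weight_cvg a w r x : radius_ge1 a -> 0 <= r ->
  (forall n, `|w n| <= r ^+ n) -> r * `|x| < 1 ->
  cvgn (pseries (fun n => a n * w n) x).
Proof.
move=> ra r0 wr rx.
have -> : pseries (fun n => a n * w n) x = series (fun n => a n * (w n * x ^+ n)).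
  by apply/funext => n; rewrite /pseries /series/=; under eq_bigr do rewrite -mulrA.
apply: (@radius_ge1_cvg R a _ (r * `|x|)) => //.
  by rewrite rx mulr_ge0.
by move=> n; rewrite normrM exprMn normrX ler_wpM2r ?exprn_ge0.
Qed.

Lemma pseries_diffs_weight a w :
  pseries_diffs (fun n => a n * w n) = (fun n => pseries_diffs a n * w n.+1).
Proof. by apply/funext => n; rewrite /pseries_diffs mulrA. Qed.

(** The weights decay like [r ^+ n] with [r < 1], so the radius in [x] is at least [1 / r], beyond
    1. The derivative therefore exists at the endpoint [x = 1], where the ray reaches the point of
    interest. *)
Lemma is_derive_pseries_weight a w r x : radius_ge1 a -> 0 < r < 1 ->
    (forall n, `|w n| <= r ^+ n) -> `|x| <= 1 ->
  cvgn (pseries (pseries_diffs (fun n => a n * w n)) x) /\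
  is_derive x 1 (fun t => limn (pseries (fun n => a n * w n) t))
    (limn (pseries (pseries_diffs (fun n => a n * w n)) x)).
Proof.
move=> ra /andP[r0 r1] wr x1.
have wS (v : nat -> R) : (forall n, `|v n| <= r ^+ n) -> forall n, `|v n.+1| <= r ^+ n.
  move=> vr n; apply: le_trans (vr _) _.
  by rewrite exprS ler_piMl ?exprn_ge0 ?ltW.
have ra1 := radius_ge1_diffs ra; have ra2 := radius_ge1_diffs ra1.
(* A point strictly between 1 and [1 / r]. *)
pose K := 2 / (1 + r).
have r10 : 0 < 1 + r by rewrite addr_gt0.
have K1 : 1 < K by rewrite ltr_pdivlMr// mul1r; lra.
have K0 : 0 <= K by rewrite ltW// (lt_trans ltr01).
have rK : r * `|K| < 1.
  by rewrite ger0_norm// /K mulrA ltr_pdivrMr// mul1r; lra.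
have rx : r * `|x| < 1.
  by apply: le_lt_trans rK; rewrite ler_wpM2l ?(ltW r0)// (ger0_norm K0) (le_trans x1)// ltW.
split.
  rewrite pseries_diffs_weight.
  by apply: (pseries_weight_cvg (r := r)) => //; [exact: ltW|exact: wS].
apply: (@pseries_snd_diffs _ _ K).
- by apply: (pseries_weight_cvg (r := r)) => //; exact: ltW.
- rewrite pseries_diffs_weight.
  by apply: (pseries_weight_cvg (r := r)) => //; [exact: ltW|exact: wS].
- rewrite (pseries_diffs_weight a w) (pseries_diffs_weight _ (fun n => w n.+1)).
  apply: (pseries_weight_cvg (w := fun n => w n.+2) (r := r)) => //; first exact: ltW.
  exact: (wS _ (wS _ wr)).
- by rewrite (ger0_norm K0) (le_lt_trans x1).
Qed.

Lemma series_natr_cvg (f : nat -> R) x : cvgn (pseries (pseries_diffs f) x) ->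
  series (fun n => n%:R * f n * x ^+ n) @ \oo --> x * limn (pseries (pseries_diffs f) x).
Proof.
move=> /pseries_diffs_equiv h.
have -> : series (fun n => n%:R * f n * x ^+ n) =
          (fun n => x * series (fun n => n%:R * f n * x ^+ n.-1) n).
  apply/funext => n; rewrite /series/= mulr_sumr; apply: eq_bigr => -[|k] _.
    by rewrite !mul0r mulr0.
  by rewrite /= exprS; ring.
by apply: cvgM; [exact: cvg_cst|exact: h].
Qed.

End weighted_series.

(** * Closed form of the binomial series on the disc *)

Section binomial_series.
Context {R : realType}.
Local Notation C := (R[i]).
Local Notation Re := (@complex.Re R).
Local Notation Im := (@complex.Im R).
Variable b : R.
Hypothesis b0 : 0 < b.
Local Notation c := (negbin b).

Lemma ReS (z : C) n : Re (z ^+ n.+1) = Re z * Re (z ^+ n) - Im z * Im (z ^+ n).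
Proof. by rewrite exprS; case: z => x y; case: (_ ^+ n). Qed.

Lemma ImS (z : C) n : Im (z ^+ n.+1) = Re z * Im (z ^+ n) + Im z * Re (z ^+ n).
Proof. by rewrite exprS; case: z => x y; case: (_ ^+ n). Qed.

Section ray.
Variable z : C.
Hypothesis z1 : modulus z < 1.
Let x := Re z.
Let y := Im z.
Let uc n := c n * Re (z ^+ n).
Let vc n := c n * Im (z ^+ n).
Let U (t : R) : R := limn (pseries uc t).
Let V (t : R) : R := limn (pseries vc t).
Let U' (t : R) : R := limn (pseries (pseries_diffs uc) t).
Let V' (t : R) : R := limn (pseries (pseries_diffs vc) t).
Let r := (1 + modulus z) / 2.

Let zr : modulus z < r. Proof. by rewrite /r; move: z1; lra. Qed.
Let r01 : 0 < r < 1.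
Proof. by rewrite (le_lt_trans (modulus_ge0 z) zr)/= /r; move: z1; lra. Qed.

Let Re_r n : `|Re (z ^+ n)| <= r ^+ n.
Proof.
apply: le_trans (ReX_le z n) _; rewrite lerXn2r ?nnegrE ?modulus_ge0 ?(ltW zr)//.
by case/andP: r01 => /ltW.
Qed.

Let Im_r n : `|Im (z ^+ n)| <= r ^+ n.
Proof.
apply: le_trans (ImX_le z n) _; rewrite lerXn2r ?nnegrE ?modulus_ge0 ?(ltW zr)//.
by case/andP: r01 => /ltW.
Qed.

Let cr := negbin_radius b0.

Let r_lt (t : R) : `|t| <= 1 -> r * `|t| < 1.
Proof.
case/andP: r01 => r0 r1 t1.
by apply: le_lt_trans r1; rewrite ler_piMr// ltW.
Qed.

(** Real and imaginary parts of [H' = z (t H' + b H)] for [H = U + i V]; coefficientwise this is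
    [negbinS] combined with [z ^+ n.+1 = z * z ^+ n]. *)
Let UV (t : R) : `|t| <= 1 ->
  U' t = x * (t * U' t + b * U t) - y * (t * V' t + b * V t) /\
  V' t = x * (t * V' t + b * V t) + y * (t * U' t + b * U t).
Proof.
move=> t1; have r0 : 0 <= r by case/andP: r01 => /ltW.
have [cU' _] := is_derive_pseries_weight cr r01 Re_r t1.
have [cV' _] := is_derive_pseries_weight cr r01 Im_r t1.
have cU : pseries uc t @ \oo --> U t.
  exact: (pseries_weight_cvg cr r0 Re_r (r_lt t1)).
have cV : pseries vc t @ \oo --> V t.
  exact: (pseries_weight_cvg cr r0 Im_r (r_lt t1)).
have nU := series_natr_cvg cU'; have nV := series_natr_cvg cV'.
have lin (p q : R) : (fun n => p * (series (fun n => n%:R * uc n * t ^+ n) n + b * pseries uc t n) +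
   q * (series (fun n => n%:R * vc n * t ^+ n) n + b * pseries vc t n)) @ \oo -->
   p * (t * U' t + b * U t) + q * (t * V' t + b * V t).
  apply: cvgD; apply: cvgM; (try exact: cvg_cst); apply: cvgD => //; apply: cvgM => //; exact: cvg_cst.
split; apply/cvg_lim => //.
- rewrite -mulNr; apply: cvg_trans (lin x (- y)); apply: near_eq_cvg; apply: nearW => n.
  rewrite /pseries /series/= !mulr_sumr -!big_split/= !mulr_sumr -big_split/=.
  apply: eq_bigr => k _.
  have -> : pseries_diffs uc k = (k%:R + b) * c k * (x * Re (z ^+ k) - y * Im (z ^+ k)).
    by rewrite /pseries_diffs /uc mulrA negbinS// ReS.
  by rewrite /uc /vc; ring.
- rewrite addrC; apply: cvg_trans (lin y x); apply: near_eq_cvg; apply: nearW => n.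
  rewrite /pseries /series/= !mulr_sumr -!big_split/= !mulr_sumr -big_split/=.
  apply: eq_bigr => k _.
  have -> : pseries_diffs vc k = (k%:R + b) * c k * (x * Im (z ^+ k) + y * Re (z ^+ k)).
    by rewrite /pseries_diffs /vc mulrA negbinS// ImS.
  by rewrite /uc /vc; ring.
Qed.

(** [N t] is the squared modulus of [1 - t z], and [phi t] is minus its argument, read off by [atan]
    since the real part is positive. *)
Let N (t : R) : R := (1 - t * x) ^+ 2 + (t * y) ^+ 2.
Let phi (t : R) := atan (t * y / (1 - t * x)).

Let tx1 (t : R) : 0 <= t <= 1 -> 0 < 1 - t * x.
Proof.
move=> /andP[t0 t1]; rewrite subr_gt0.
apply: le_lt_trans z1; apply: le_trans (Re_le_modulus z).
apply: le_trans (ler_norm _) _; rewrite normrM ler_piMl//.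
by rewrite ger0_norm.
Qed.

Let N0 (t : R) : 0 <= t <= 1 -> 0 < N t.
Proof. by move=> t01; rewrite /N ltr_wpDr ?sqr_ge0// exprn_gt0 ?tx1. Qed.

Let dtx (t k : R) : is_derive t 1 (fun s => s * k) k.
Proof.
apply: is_derive_congr (is_deriveM (is_derive_id t (1 : R)) (is_derive_cst k t (1 : R))) _ _ => //.
by rewrite /GRing.scale/= mulr0 add0r mulr1.
Qed.

Let d1tx (t : R) : is_derive t 1 (fun s => 1 - s * x) (- x).
Proof.
apply: is_derive_congr (is_deriveB (is_derive_cst (1 : R) t (1 : R)) (dtx t x)) _ _ => //.
by rewrite sub0r.
Qed.

Let dN (t : R) : is_derive t 1 N (- (2 * x * (1 - t * x)) + 2 * t * y ^+ 2).
Proof.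
apply: is_derive_congr (is_deriveD (is_deriveX 2 (d1tx t)) (is_deriveX 2 (dtx t y))) _ _ => //.
by rewrite /GRing.scale/=; ring.
Qed.

Let dphi (t : R) : 0 <= t <= 1 -> is_derive t 1 phi (y / N t).
Proof.
move=> t01; have t0 := tx1 t01; have n0 := N0 t01.
have t0' : 1 - t * x != 0 by rewrite gt_eqF.
have dq := is_deriveM (dtx t y) (is_deriveV (f := fun s : R => 1 - s * x) t0' (d1tx t)).
apply: is_derive_congr (is_derive1_comp (is_derive1_atan _) dq) _ _ => //.
rewrite /GRing.scale/= /N.
have -> : 1 + (t * y / (1 - t * x)) ^+ 2 = N t / (1 - t * x) ^+ 2.
  by rewrite /N; field.
have NE : N t != 0 by rewrite gt_eqF.
rewrite -/(N t); by field; rewrite t0' NE.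
Qed.

(** Half the derivative of [N]; also minus the real part of [z * conj (1 - t z)], whose imaginary
    part is [y]. *)
Let dN_half (t : R) := t * y ^+ 2 - x * (1 - t * x).

(** Multiply [(1 - t z) H' = b z H] by the conjugate of [1 - t z], so that [N t] replaces the
    complex factor on the left. *)
Let NUV (t : R) : 0 <= t <= 1 ->
  N t * U' t = b * (- dN_half t * U t - y * V t) /\
  N t * V' t = b * (- dN_half t * V t + y * U t).
Proof.
move=> /andP[t0 t1]; have [H1 H2] := @UV t ltac:(by rewrite ger0_norm).
have E1 : (1 - t * x) * U' t + t * y * V' t - b * (x * U t - y * V t) = 0.
  by apply/eqP; rewrite -(subrr (U' t)) {3}H1; apply/eqP; ring.
have E2 : (1 - t * x) * V' t - t * y * U' t - b * (x * V t + y * U t) = 0.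
  by apply/eqP; rewrite -(subrr (V' t)) {3}H2; apply/eqP; ring.
split; apply/eqP; rewrite -subr_eq0; apply/eqP; rewrite /N /dN_half.
- transitivity ((1 - t * x) * ((1 - t * x) * U' t + t * y * V' t - b * (x * U t - y * V t)) -
     t * y * ((1 - t * x) * V' t - t * y * U' t - b * (x * V t + y * U t))); first by ring.
  by rewrite E1 E2 !mulr0 subrr.
- transitivity (t * y * ((1 - t * x) * U' t + t * y * V' t - b * (x * U t - y * V t)) +
     (1 - t * x) * ((1 - t * x) * V' t - t * y * U' t - b * (x * V t + y * U t))); first by ring.
  by rewrite E1 E2 !mulr0 addr0.
Qed.

Let dNp (t : R) : 0 <= t <= 1 ->
  is_derive t 1 (fun s => N s `^ (b / 2)) (b * N t `^ (b / 2 - 1) * dN_half t).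
Proof.
move=> t01; apply: is_derive_congr (is_derive_powR_comp (b / 2) (N0 t01) (dN t)) _ _ => //.
by rewrite /dN_half; field.
Qed.

Let dbphi (t : R) : 0 <= t <= 1 -> is_derive t 1 (fun s => b * phi s) (b * y / N t).
Proof.
move=> t01; apply: is_derive_congr (is_deriveM (is_derive_cst b t (1 : R)) (dphi t01)) _ _ => //.
by rewrite /GRing.scale/= mulr0 addr0 mulrA.
Qed.

Let dUV (t : R) : 0 <= t <= 1 -> is_derive t 1 U (U' t) /\ is_derive t 1 V (V' t).
Proof.
move=> /andP[t0 t1]; have tt : `|t| <= 1 by rewrite ger0_norm.
have [_ dU] := is_derive_pseries_weight cr r01 Re_r tt.
by have [_ dV] := is_derive_pseries_weight cr r01 Im_r tt.
Qed.

(* On the ray [t |-> t z] the sum [H = U + i V] satisfies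
   [(1 - t z) H' = b z H], so [P + i Q = (1 - t z) ^ b * H] is constant. *)
Let P (t : R) := N t `^ (b / 2) * (U t * cos (b * phi t) + V t * sin (b * phi t)).
Let Q (t : R) := N t `^ (b / 2) * (V t * cos (b * phi t) - U t * sin (b * phi t)).

Let dPQ (t : R) : 0 <= t <= 1 -> is_derive t 1 P 0 /\ is_derive t 1 Q 0.
Proof.
move=> t01; have [dU dV] := dUV t01; have [NU NV] := NUV t01.
have n0 := N0 t01; have n0' : N t != 0 by rewrite gt_eqF.
(* Splitting off one factor [N t] makes the products [N t * U' t] and [N t * V' t] appear, to which
   [NUV] applies. *)
have NE : N t `^ (b / 2) = N t * N t `^ (b / 2 - 1).
  by rewrite mulr_powRB1 ?divr_gt0// ltW.
have dcos := is_derive1_comp (is_derive_cos _) (dbphi t01).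
have dsin := is_derive1_comp (is_derive_sin _) (dbphi t01).
set E := N t `^ (b / 2 - 1) in NE.
set C := cos (b * phi t); set S := sin (b * phi t).
split.
- apply: is_derive_congr (is_deriveM (dNp t01) (is_deriveD (is_deriveM dU dcos) (is_deriveM dV dsin))) _ _ => //.
  rewrite /GRing.scale/= !fctE/= -/C -/S -/E NE.
  transitivity (E * (C * (N t * U' t) + S * (N t * V' t) + b * y * (V t * C - U t * S) +
     b * dN_half t * (U t * C + V t * S))); first by field.
  by rewrite NU NV; ring.
- apply: is_derive_congr (is_deriveM (dNp t01) (is_deriveB (is_deriveM dV dcos) (is_deriveM dU dsin))) _ _ => //.
  rewrite /GRing.scale/= !fctE/= -/C -/S -/E NE.
  transitivity (E * (C * (N t * V' t) - S * (N t * U' t) - b * y * (V t * S + U t * C) +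
     b * dN_half t * (V t * C - U t * S))); first by field.
  by rewrite NU NV; ring.
Qed.

Let cst01 (F : R -> R) : (forall t : R, 0 <= t <= 1 -> is_derive t 1 F 0) -> F 1 = F 0.
Proof.
move=> dF; have [||t _] := @MVT R F (fun=> 0) 0 1 ltr01.
- by move=> t; rewrite in_itv/= => /andP[t0 t1]; apply: dF; rewrite !ltW.
- apply: continuous_in_subspaceT => t; rewrite inE/= in_itv/= => t01.
  exact: is_derive_continuous (dF _ t01).
- by rewrite mul0r => /eqP; rewrite subr_eq0 => /eqP.
Qed.

Let pseries_at0 (f : nat -> R) : limn (pseries f 0) = f 0%N.
Proof.
apply/cvg_lim => //; rewrite -(cvg_shiftn 1)/=; apply: cvg_near_cst; apply: nearW => n.
rewrite /pseries /series/= addn1 big_nat_recl//= expr0 mulr1.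
by rewrite big1 ?addr0// => i _; rewrite expr0n mulr0.
Qed.

Let pseries_at1 (f : nat -> R) : pseries f 1 = series f.
Proof. by apply/funext => n; rewrite /pseries /series/=; under eq_bigr do rewrite expr1n mulr1. Qed.

(** The hypotheses say [(p + i q) (C - i S) = 1] with [C + i S] on the unit circle; multiply by
    [C + i S]. *)
Let rot (p q C S : R) : C ^+ 2 + S ^+ 2 = 1 -> p * C + q * S = 1 -> q * C - p * S = 0 ->
  p = C /\ q = S.
Proof.
move=> CS pq1 pq2; split.
  transitivity (p * (C ^+ 2 + S ^+ 2)); first by rewrite CS mulr1.
  transitivity ((p * C + q * S) * C - (q * C - p * S) * S); first by ring.
  by rewrite pq1 pq2 mul1r mul0r subr0.
transitivity (q * (C ^+ 2 + S ^+ 2)); first by rewrite CS mulr1.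
transitivity ((p * C + q * S) * S + (q * C - p * S) * C); first by ring.
by rewrite pq1 pq2 mul1r mul0r addr0.
Qed.

(** [P + i Q] equals 1 at [t = 0], hence at [t = 1], where [U] and [V] are the two series; undoing
    the rotation and the factor [N 1 ^ (b / 2)] isolates them. *)
Lemma negbin_series_ray :
  limn (series uc) = modulus (1 - z) `^ (- b) * cos (b * atan (y / (1 - x))) /\
  limn (series vc) = modulus (1 - z) `^ (- b) * sin (b * atan (y / (1 - x))).
Proof.
have P1 := cst01 (fun t t01 => (dPQ t01).1).
have Q1 := cst01 (fun t t01 => (dPQ t01).2).
have N1 : N 0 = 1 by rewrite /N !mul0r subr0 expr1n expr0n addr0.
have phi0 : phi 0 = 0 by rewrite /phi !mul0r atan0.
have U0 : U 0 = 1 by rewrite /U pseries_at0 /uc negbin0// expr0 mul1r.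
have V0 : V 0 = 0 by rewrite /V pseries_at0 /vc expr0 mulr0.
rewrite /P N1 phi0 U0 V0 mulr0 cos0 mul0r addr0 mulr1 powR1 mulr1 in P1.
rewrite /Q N1 phi0 U0 V0 mulr0 sin0 mulr0 mul0r subrr mulr0 in Q1.
have Nm : modulus (1 - z) `^ (- b) = (N 1 `^ (b / 2))^-1.
  rewrite modulusE powRN -powR12_sqrt ?addr_ge0 ?sqr_ge0//.
  rewrite -powRrM mulrC; congr (_ `^ _)^-1.
  by rewrite /N /x /y !mul1r; case: (z) => u v /=; rewrite sub0r sqrrN.
have np : 0 < N 1 `^ (b / 2) by rewrite powR_gt0// N0// lexx ler01.
have -> : y / (1 - x) = 1 * y / (1 - 1 * x) by rewrite !mul1r.
rewrite -/(phi 1) Nm.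
have [] := @rot (N 1 `^ (b / 2) * U 1) (N 1 `^ (b / 2) * V 1) (cos (b * phi 1)) (sin (b * phi 1)).
- exact: cos2Dsin2.
- by apply: etrans P1; ring.
- by apply: etrans Q1; ring.
move=> <- <-; rewrite /U /V !pseries_at1 !mulrA mulVf ?gt_eqF// !mul1r.
by [].
Qed.

End ray.

(* The sum is [(1 - z) ^ (- b)]: as [Re (1 - z) > 0], the argument of [1 - z] is
   [- atan (Im z / (1 - Re z))]. *)
Lemma negbin_series (z : C) : modulus z < 1 ->
  limn (series (fun n => c n * Re (z ^+ n))) =
    modulus (1 - z) `^ (- b) * cos (b * atan (Im z / (1 - Re z))) /\
  limn (series (fun n => c n * Im (z ^+ n))) =
    modulus (1 - z) `^ (- b) * sin (b * atan (Im z / (1 - Re z))).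
Proof. exact: negbin_series_ray. Qed.

End binomial_series.

(** * Analyticity and uniqueness of expansions *)

Section analyticity.
Context {R : realType}.
Local Notation C := (R[i]).
Local Notation Re := (@complex.Re R).
Local Notation Im := (@complex.Im R).
Implicit Types (z h : C) (a : nat -> R) (n : nat) (q : R).

Lemma modulus_sum_le n (F : nat -> C) :
  modulus (\sum_(0 <= k < n) F k) <= \sum_(0 <= k < n) modulus (F k).
Proof.
elim: n => [|n IH]; first by rewrite !big_nil modulus0.
by rewrite !big_nat_recr//= (le_trans (modulusD _ _))// lerD2r.
Qed.

(* First order Taylor remainder of [z ^+ n]; the factor [q ^+ 2] on the left
   keeps the exponent on the right free of truncated subtractions. *)
Lemma modulus_taylor1_expr z h q n : 0 < q -> modulus z <= q -> modulus (z + h) <= q ->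
  q ^+ 2 * modulus ((z + h) ^+ n - z ^+ n - n%:R * z ^+ n.-1 * h) <=
    n%:R ^+ 2 * q ^+ n * modulus h ^+ 2.
Proof.
move=> q0 zq zhq; have q0' := ltW q0.
elim: n => [|n IH].
  have -> : (z + h) ^+ 0 - z ^+ 0 - 0%:R * z ^+ 0.-1 * h = 0 by rewrite !expr0 mul0r; ring.
  by rewrite modulus0// mulr0 expr0n/= !mul0r.
(* The exponent [n.-1] is truncated only at [n = 0], where the factor [n%:R] vanishes. *)
have zn : z ^+ n * n%:R = n%:R * z ^+ n.-1 * z.
  by case: n {IH} => [|n] /=; rewrite ?mulr0 ?mul0r// exprSr; ring.
have -> : (z + h) ^+ n.+1 - z ^+ n.+1 - n.+1%:R * z ^+ n.+1.-1 * h =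
  (z + h) * ((z + h) ^+ n - z ^+ n - n%:R * z ^+ n.-1 * h) + n%:R * z ^+ n.-1 * h ^+ 2.
  transitivity ((z + h) * ((z + h) ^+ n - z ^+ n - n%:R * z ^+ n.-1 * h)
     + (n%:R * z ^+ n.-1 * z * h + n%:R * z ^+ n.-1 * h ^+ 2 - z ^+ n * n%:R * h)).
    by rewrite /= !exprS -natr1; ring.
  by rewrite zn; ring.
have m2 : q ^+ 2 * modulus (n%:R * z ^+ n.-1 * h ^+ 2) <= n%:R * q ^+ n.+1 * modulus h ^+ 2.
  rewrite modulusM (modulusX h) (modulusM n%:R) (modulusX z).
  rewrite modulus_natr.
  rewrite mulrA ler_wpM2r ?exprn_ge0 ?modulus_ge0//.
  case: n {IH zn} => [|n] /=; first by rewrite !mul0r mulr0.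
  rewrite mulrCA ler_wpM2l// -[n.+2]add2n exprD ler_wpM2l ?exprn_ge0//.
  by rewrite lerXn2r ?nnegrE ?modulus_ge0.
have m1 : q ^+ 2 * modulus ((z + h) * ((z + h) ^+ n - z ^+ n - n%:R * z ^+ n.-1 * h)) <=
    q * (n%:R ^+ 2 * q ^+ n * modulus h ^+ 2).
  rewrite modulusM mulrCA; apply: ler_pM => //; first exact: modulus_ge0.
  by rewrite mulr_ge0 ?exprn_ge0 ?modulus_ge0.
apply: le_trans (ler_wpM2l (exprn_ge0 2 q0') (modulusD _ _)) _.
rewrite mulrDr; apply: le_trans (lerD m1 m2) _.
have -> : q * (n%:R ^+ 2 * q ^+ n * modulus h ^+ 2) + n%:R * q ^+ n.+1 * modulus h ^+ 2 =
  (n%:R ^+ 2 + n%:R) * q ^+ n.+1 * modulus h ^+ 2 by rewrite [q ^+ n.+1]exprS; ring.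
rewrite ler_wpM2r ?exprn_ge0 ?modulus_ge0// ler_wpM2r ?exprn_ge0//.
rewrite -natr1 -subr_ge0.
have -> : (n%:R + 1) ^+ 2 - (n%:R ^+ 2 + n%:R) = n%:R + 1 :> R by ring.
by rewrite addr_ge0.
Qed.

Lemma radius_ge1_natr a : radius_ge1 a -> radius_ge1 (fun n => n%:R * a n).
Proof.
move=> /radius_ge1_diffs ra q q01; have [M aM] := ra q q01.
have [q0 q1] := andP q01.
exists (q * M) => -[|n].
  rewrite mul0r normr0 mul0r mulr_ge0 ?(ltW q0)//.
  by apply: le_trans (aM 0%N); rewrite mulr_ge0// exprn_ge0// ltW.
by rewrite exprS mulrCA; apply: ler_wpM2l; [exact: ltW|exact: aM].
Qed.

Lemma cvgC_modulus_le (u : nat -> C^o) (l : C^o) (K : R) : u @ \oo --> l ->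
  (forall n, modulus (u n) <= K) -> modulus l <= K.
Proof.
move=> /cvgC_modulus ul uK.
have h1 : modulus l @[n --> \oo] --> modulus l by exact: cvg_cst.
have h2 : (K + modulus (u n - l)) @[n --> \oo] --> K.
  by rewrite -[X in _ --> X]addr0; apply: cvgD => //; exact: cvg_cst.
apply: (ler_cvg_to h1 h2); apply: nearW => n; rewrite -{1}(subKr (u n) l).
by rewrite (le_trans (modulusD _ _))// modulusN lerD2r.
Qed.

(** The derived series lags by one index; after this shift the three partial sums in the Taylor
    remainder combine term by term. *)
Lemma power_sums_diffs a z n :
  power_sums (fun k => (pseries_diffs a k)%:C%C) z n =
  \sum_(0 <= k < n.+1) (a k)%:C%C * (k%:R * z ^+ k.-1).
Proof.
rewrite big_nat_recl//= mul0r mulr0 add0r; apply: eq_bigr => k _.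
by rewrite /pseries_diffs rmorphM rmorph_nat/=; ring.
Qed.

(** Sum the remainders of the monomials at a radius [q] between [|z|] and 1. The constant is the sum
    of [n ^ 2 |a n| q ^ n], divided by [q ^ 2], finite because factors [n] do not shrink the
    radius. *)
Lemma power_series_taylor1 a z : radius_ge1 a -> disc z ->
  exists K, exists2 d, 0 < d & forall h, modulus h < d ->
    modulus (power_series (fun k => (a k)%:C%C) (z + h) - power_series (fun k => (a k)%:C%C) z
      - power_series (fun k => (pseries_diffs a k)%:C%C) z * h) <= K * modulus h ^+ 2.
Proof.
move=> ra z1.
pose q := (1 + modulus z) / 2.
have zq : modulus z < q by rewrite /q; move: z1; rewrite /disc/=; lra.
have q1 : q < 1 by rewrite /q; move: z1; rewrite /disc/=; lra.
have q0 : 0 < q by rewrite (le_lt_trans _ zq) ?modulus_ge0.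
have ra2 := radius_ge1_natr (radius_ge1_natr ra).
have cK : cvgn (series (fun n => `|n%:R * (n%:R * a n)| * q ^+ n)).
  by apply: radius_ge1_cvg_norm => //; rewrite q1 ltW.
exists (limn (series (fun n => `|n%:R * (n%:R * a n)| * q ^+ n)) / q ^+ 2).
exists (q - modulus z); first by rewrite subr_gt0.
move=> h hd.
have zhq : modulus (z + h) <= q.
  by rewrite (le_trans (modulusD _ _))// addrC -lerBrDr ltW.
have zh1 : disc (z + h) by rewrite /disc/= (le_lt_trans zhq).
pose S n : C^o := power_sums (fun k => (a k)%:C%C) (z + h) n.+1
  - power_sums (fun k => (a k)%:C%C) z n.+1
  - power_sums (fun k => (pseries_diffs a k)%:C%C) z n * h.
have cS : S @ \oo --> (power_series (fun k => (a k)%:C%C) (z + h) - power_series (fun k => (a k)%:C%C) z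
      - power_series (fun k => (pseries_diffs a k)%:C%C) z * h : C^o).
  have e1 := power_series_expansion ra zh1.
  have e2 := power_series_expansion ra z1.
  have e3 := power_series_expansion (radius_ge1_diffs ra) z1.
  apply: cvgB.
    apply: cvgB; [move: e1|move: e2]; rewrite -(cvg_shiftS _) => e; exact: e.
  by apply: (@cvgM C^o); [exact: e3|exact: cvg_cst].
apply: (cvgC_modulus_le cS) => n.
have -> : S n = \sum_(0 <= k < n.+1) ((a k)%:C%C * ((z + h) ^+ k - z ^+ k - k%:R * z ^+ k.-1 * h)).
  rewrite /S power_sums_diffs /power_sums /series/= mulr_suml -!sumrB.
  by apply: eq_bigr => k _; ring.
apply: le_trans (modulus_sum_le _ _) _.
rewrite mulrAC ler_pdivlMr ?exprn_gt0//.
apply: le_trans (_ : series (fun n => `|n%:R * (n%:R * a n)| * q ^+ n) n.+1 * modulus h ^+ 2 <= _).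
  rewrite /series/= !mulr_suml; apply: ler_sum => k _.
  rewrite modulusM modulus_real -[leLHS]mulrA (mulrC _ (q ^+ 2)).
  apply: le_trans (ler_wpM2l (normr_ge0 _) (modulus_taylor1_expr k q0 (ltW zq) zhq)) _.
  by rewrite !normrM normr_nat le_eqVlt; apply/orP; left; apply/eqP; ring.
rewrite ler_wpM2r ?exprn_ge0 ?modulus_ge0//.
apply: nondecreasing_cvgn_le => //.
apply/nondecreasing_seqP => k; rewrite /series/= big_nat_recr//= lerDl.
by rewrite mulr_ge0// exprn_ge0// ltW.
Qed.

Lemma power_series_analytic a : radius_ge1 a ->
  analytic_on_disc (power_series (fun k => (a k)%:C%C)).
Proof.
move=> ra z z1; have [K [d d0 HK]] := power_series_taylor1 ra z1.
set f := power_series _ in HK *.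
set L := power_series (fun k => (pseries_diffs a k)%:C%C) z in HK.
apply/cvg_ex; exists (L : C^o); apply/cvgrPdist_lt => /= e.
rewrite ltcE/= => /andP[/eqP Ie Re0].
pose M : R := `|K| + 1; have M0 : 0 < M by rewrite ltr_wpDl.
pose m : R := Num.min d (Re e / M).
have m0 : (0 : C) < m%:C%C by rewrite ltcR lt_min d0 divr_gt0.
have nearm := @dnbhs0_lt C C^o _ m0.
near=> h.
have h0 : h != 0 by near: h; exact: (@nbhs_dnbhs_neq C^o).
have hm : modulus h < m by rewrite -ltcR -normC_modulus; near: h; exact: nearm.
have hd : modulus h < d by rewrite (lt_le_trans hm)// ge_min lexx.
have hM : modulus h * M < Re e.
  by rewrite -ltr_pdivlMr// (lt_le_trans hm)// ge_min lexx orbT.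
have mh0 : 0 < modulus h by rewrite lt_def modulus_eq0 h0 modulus_ge0.
rewrite distrC normC_modulus ltcE/= -Ie eqxx/=.
have -> : h^-1 *: ((f \o shift z) (h *: (1 : C^o)) - f z) - L =
          h^-1 * (f (z + h) - f z - L * h).
  rewrite /= /GRing.scale/= mulr1 (addrC h z) [RHS]mulrBr; congr (_ - _).
  by rewrite mulrC mulfK.
rewrite modulusM modulusV.
apply: le_lt_trans hM; rewrite mulrC ler_pdivrMr//.
apply: le_trans (HK _ hd) _.
rewrite mulrAC -expr2 mulrC ler_wpM2l ?exprn_ge0 ?modulus_ge0//.
by rewrite (le_trans (ler_norm _))// lerDl.
Unshelve. all: by end_near. Qed.

(* Comparing the lowest nonzero coefficient with the geometrically bounded tail
   of the series at points tending to [0]. *)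
Lemma expansion0_eq0 (d : nat -> C) :
  (forall z, disc z -> power_sums d z @ \oo --> (0 : C^o)) -> d = fun=> 0.
Proof.
move=> d0.
have half1 : disc (2^-1%:C%C : C).
  by rewrite discE modulus_real ger0_norm ?invr_ge0// invf_lt1// ltr1n.
have /cvgC_modulus := d0 _ half1.
have -> : (fun n => modulus (power_sums d 2^-1%:C%C n - 0)) =
          (fun n => modulus (power_sums d 2^-1%:C%C n)).
  by apply/funext => n; rewrite subr0.
move=> hc; have [B [_ HB]] := cvg_seq_bounded (cvgP _ hc).
pose M := 2 * (`|B| + 1).
have SM n : modulus (power_sums d 2^-1%:C%C n) <= `|B| + 1.
  rewrite -[leLHS]ger0_norm ?modulus_ge0//.
  by apply: HB => //; rewrite (le_lt_trans (ler_norm B))// ltrDl.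
(* A term is the difference of two successive partial sums at [1 / 2], and those are bounded. *)
have dM n : modulus (d n) <= M * 2 ^+ n.
  have -> : d n = (power_sums d 2^-1%:C%C n.+1 - power_sums d 2^-1%:C%C n) * 2 ^+ n.
    rewrite /power_sums /series/= big_nat_recr//= addrAC subrr add0r -mulrA -exprMn.
    by rewrite -(rmorph_nat (real_complex R) 2) -rmorphM/= mulVf// expr1n mulr1.
  rewrite modulusM modulusX modulus_natr ler_wpM2r ?exprn_ge0//.
  rewrite (le_trans (modulusD _ _))// modulusN /M mulr_natl mulr2n.
  by apply: lerD.
have M0 : 0 <= M by rewrite /M mulr_ge0// addr_ge0.
apply/funext => m; apply/eqP; rewrite -modulus_eq0.
elim/ltn_ind: m => m IH.
have S0 x : power_sums d x m = 0.
  rewrite /power_sums /series/= big_nat_cond big1// => k /andP[/andP[_ km] _].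
  by have := IH _ km; rewrite modulus_eq0 => /eqP ->; rewrite mul0r.
(* With [x <= 1 / 4] the tail has ratio [2 x <= 1 / 2], so it is at most twice the bound on its
   first term; dividing by [x ^+ m] leaves one factor [x]. *)
have key (x : R) : 0 < x <= 4^-1 -> modulus (d m) <= 4 * M * 2 ^+ m * x.
  move=> /andP[x0 x4].
  have x1 : disc (x%:C%C : C).
    by rewrite discE modulus_real gtr0_norm// (le_lt_trans x4)// invf_lt1// ltr1n.
  (* The factor [1 - (2 * x) ^+ j] makes the induction close: its increment covers the next term
     exactly when [4 * x <= 1]. *)
  have tail j : modulus (power_sums d x%:C%C (m.+1 + j) - d m * x%:C%C ^+ m) <=
      2 * M * (2 * x) ^+ m.+1 * (1 - (2 * x) ^+ j).
    elim: j => [|j IHj].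
      rewrite addn0 /power_sums /series/= big_nat_recr//=.
      have := S0 x%:C%C; rewrite /power_sums /series/= => ->.
      by rewrite add0r subrr modulus0 expr0 subrr mulr0.
    have -> : power_sums d x%:C%C (m.+1 + j.+1) = power_sums d x%:C%C (m.+1 + j) + d (m.+1 + j)%N * x%:C%C ^+ (m.+1 + j).
      by rewrite addnS /power_sums /series/= big_nat_recr.
    rewrite addrAC; apply: le_trans (modulusD _ _) _.
    have tj : modulus (d (m.+1 + j)%N * x%:C%C ^+ (m.+1 + j)) <= M * (2 * x) ^+ (m.+1 + j).
      rewrite modulusM modulusX modulus_real (gtr0_norm x0) exprMn mulrA.
      by rewrite ler_wpM2r ?exprn_ge0 ?(ltW x0).
    apply: le_trans (lerD IHj tj) _.
    rewrite -subr_ge0.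
    have -> : 2 * M * (2 * x) ^+ m.+1 * (1 - (2 * x) ^+ j.+1) -
      (2 * M * (2 * x) ^+ m.+1 * (1 - (2 * x) ^+ j) + M * (2 * x) ^+ (m.+1 + j)) =
      M * ((2 * x) ^+ m.+1 * (2 * x) ^+ j) * (1 - 4 * x).
      by rewrite exprD !exprS; ring.
    rewrite mulr_ge0//; first by rewrite mulr_ge0// mulr_ge0// exprn_ge0// mulr_ge0// ltW.
    by rewrite subr_ge0 mulrC -ler_pdivlMr// mul1r.
  have xm0 : 0 < x ^+ m by rewrite exprn_gt0.
  rewrite -(ler_pM2r xm0).
  have -> : 4 * M * 2 ^+ m * x * x ^+ m = 2 * M * (2 * x) ^+ m.+1.
    by rewrite exprMn !exprS; ring.
  have -> : modulus (d m) * x ^+ m = modulus (d m * x%:C%C ^+ m).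
    by rewrite modulusM modulusX modulus_real (gtr0_norm x0).
  have := d0 _ x1; rewrite -(cvg_shiftn m.+1) => hS.
  have : (fun n => d m * x%:C%C ^+ m - power_sums d x%:C%C (n + m.+1)%N : C^o) @ \oo --> (d m * x%:C%C ^+ m : C^o).
    by rewrite -[X in _ --> X]subr0; apply: cvgB; [exact: cvg_cst|exact: hS].
  move=> /cvgC_modulus_le; apply => n.
  rewrite -modulusN opprB addnC; apply: le_trans (tail n) _.
  rewrite ler_piMr//; first by rewrite mulr_ge0 ?exprn_ge0// ?mulr_ge0// ltW.
  by rewrite gerBl exprn_ge0// mulr_ge0// ltW.
rewrite eq_le modulus_ge0 andbT; apply/ler_addgt0Pr => e e0; rewrite add0r.
pose k := 4 * M * 2 ^+ m; have k0 : 0 <= k by rewrite mulr_ge0 ?exprn_ge0// mulr_ge0.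
pose x := Num.min 4^-1 (e / (k + 1)).
have k10 : 0 < k + 1 by rewrite ltr_wpDl.
apply: le_trans (key x _) _.
  by rewrite lt_min invr_gt0 ltr0n/= divr_gt0//= ge_min lexx.
apply: le_trans (_ : k * (e / (k + 1)) <= _).
  by rewrite ler_wpM2l// ge_min lexx orbT.
by rewrite mulrA ler_pdivrMr// mulrC ler_wpM2l ?(ltW e0)// lerDl.
Qed.

(** The difference of two expansions of the same function expands 0, so [expansion0_eq0] makes them
    equal. *)
Lemma coefs_power_series a : radius_ge1 a ->
  coefs (power_series (fun k => (a k)%:C%C)) = (fun k => (a k)%:C%C).
Proof.
move=> ra; apply: xget_subset1; first exact: power_series_expansion.
move=> u v /= eu ev.
have uv0 : (fun n => u n - v n) = fun=> 0.
  apply: expansion0_eq0 => z z1.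
  have -> : power_sums (fun n => u n - v n) z = power_sums u z - power_sums v z.
    apply/funext => n; rewrite !fctE /power_sums /series/= -sumrB.
    by apply: eq_bigr => k _; rewrite mulrBl.
  rewrite -(subrr (power_series (fun k => (a k)%:C%C) z)).
  by apply: cvgB; [exact: eu|exact: ev].
apply/funext => n; apply/eqP; rewrite -subr_eq0; apply/eqP.
exact: (congr1 (fun g => g n) uv0).
Qed.

End analyticity.

(** * Integral representation and Carleson estimates *)

Section integral_representation.
Context {R : realType}.
Local Notation C := (R[i]).
Local Notation Re := (@complex.Re R).
Local Notation Im := (@complex.Im R).
Variable mu : {finite_measure set (measurableTypeR R) -> \bar R}.
Local Notation I01 := (`[0, 1[%classic : set (measurableTypeR R)).

Lemma bounded_integrable (g : measurableTypeR R -> R) (M : R) : measurable_fun I01 g ->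
  (forall t : R, 0 <= t < 1 -> `|g t| <= M) -> mu.-integrable I01 (EFin \o g).
Proof.
move=> mg gM.
have mI : measurable I01 by exact: measurable_itv.
apply: (le_integrable mI _ _ (finite_measure_integrable_cst mu M mI)).
  exact/measurable_EFinP.
move=> t; rewrite /= in_itv/= => t01; rewrite lee_fin (le_trans (gM _ t01))//.
exact: ler_norm.
Qed.

Lemma integrable_expr n : mu.-integrable I01 (EFin \o (fun t : R => t ^+ n)).
Proof.
apply: (bounded_integrable (M := 1)); first exact: measurable_funX.
move=> t /andP[t0 t1]; rewrite ger0_norm ?exprn_ge0//.
by rewrite exprn_ile1// ltW.
Qed.

Lemma moment_le n : `|moment mu n| <= fine (mu I01).
Proof.
have mI : measurable I01 by exact: measurable_itv.
have -> : fine (mu I01) = \int[mu]_(t in I01) (1 : R) by rewrite Rintegral_cst// mul1r.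
apply: le_trans (le_normr_Rintegral mI (integrable_expr n)) _.
apply: le_Rintegral => //.
- exact: (integrable_abse (integrable_expr n)).
- exact: (finite_measure_integrable_cst mu 1 mI).
move=> t; rewrite /= in_itv/= => /andP[t0 t1].
by rewrite ger0_norm ?exprn_ge0// exprn_ile1// ltW.
Qed.

Lemma radius_ge1_moment (a : nat -> R) : radius_ge1 a ->
  radius_ge1 (fun n => a n * moment mu n).
Proof. by move=> ra; exact: radius_ge1M moment_le ra. Qed.

(** Termwise integration by dominated convergence: all partial sums are bounded by the constant [G],
    integrable because [mu] is finite. Measurability of [h] comes from its being their pointwise
    limit. *)
Lemma series_moment (a w : nat -> R) (h : R -> R) (r : R) :
    radius_ge1 a -> 0 <= r < 1 -> (forall n, `|w n| <= r ^+ n) ->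
    (forall t : R, 0 <= t < 1 -> limn (series (fun n => a n * (w n * t ^+ n))) = h t) ->
  mu.-integrable I01 (EFin \o h) /\
  limn (series (fun n => a n * moment mu n * w n)) = \int[mu]_(t in I01) h t.
Proof.
move=> ra r01 wr hE.
have mI : measurable I01 by exact: measurable_itv.
pose G := limn (series (fun n => `|a n| * r ^+ n)).
have cG := radius_ge1_cvg_norm ra r01.
pose u (N : nat) (t : R) := series (fun n => a n * (w n * t ^+ n)) N.
have wt (t : R) n : 0 <= t < 1 -> `|w n * t ^+ n| <= r ^+ n.
  move=> /andP[t0 t1]; rewrite normrM -[leRHS]mulr1; apply: ler_pM => //.
  by rewrite ger0_norm ?exprn_ge0// exprn_ile1// ltW.
have uG N (t : R) : 0 <= t < 1 -> `|u N t| <= G.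
  move=> t01; apply: (@le_trans _ _ (series (fun n => `|a n| * r ^+ n) N)).
    apply: le_trans (ler_norm_sum _ _ _) _; apply: ler_sum => n _.
    by rewrite normrM ler_wpM2l// wt.
  apply: nondecreasing_cvgn_le => //.
  apply/nondecreasing_seqP => k; rewrite /series/= big_nat_recr//= lerDl.
  by rewrite mulr_ge0// exprn_ge0//; case/andP: r01.
have mterm n : measurable_fun I01 (fun t : R => a n * (w n * t ^+ n)).
  by apply: measurable_funM => //; apply: measurable_funM => //; exact: measurable_funX.
have mu_ N : measurable_fun I01 (u N).
  exact: (measurable_sum _ mterm).
have iu N : mu.-integrable I01 (EFin \o u N) by exact: bounded_integrable (mu_ N) (uG N).
have ucvg (t : R) : 0 <= t < 1 -> u N t @[N --> \oo] --> h t.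
  by move=> t01; rewrite -hE//; apply: (radius_ge1_cvg ra r01) => n; exact: wt.
have mh : measurable_fun I01 h.
  apply: (measurable_fun_cvg mu_) => t; rewrite /= in_itv/=; exact: ucvg.
have intu N : \int[mu]_(t in I01) u N t = series (fun n => a n * moment mu n * w n) N.
  elim: N => [|N IH].
    rewrite (_ : u 0 = fun=> 0) ?Rintegral_cst ?mul0r//; first by rewrite /series/= big_nil.
    by apply/funext => t; rewrite /u /series/= big_nil.
  rewrite (_ : u N.+1 = fun t => u N t + (a N * w N) * t ^+ N); last first.
    by apply/funext => t; rewrite /u /series/= big_nat_recr//= mulrA.
  have ie := integrable_expr N.
  rewrite RintegralD//; last exact: (integrableZl mI (a N * w N) ie).
  rewrite IH RintegralZl// /series/= big_nat_recr//=; congr (_ + _).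
  by rewrite /moment mulrAC.
have [ih _ hcvg] := dominated_convergence (mu := mu) (f_ := fun N => EFin \o u N)
  (f := EFin \o h) (g := fun=> G%:E) mI
  ltac:(by move=> N; exact/measurable_EFinP) ltac:(exact/measurable_EFinP)
  ltac:(by apply: aeW => t; rewrite /= in_itv/= => t01; apply: cvg_EFin; [exact: nearW|exact: ucvg])
  (finite_measure_integrable_cst mu G mI)
  ltac:(by apply: aeW => t N; rewrite /= in_itv/= => t01; rewrite lee_fin uG).
split=> //; apply/cvg_lim => //.
have hE' : (\int[mu]_(t in I01) (EFin \o h) t = (\int[mu]_(t in I01) h t)%:E)%E.
  by rewrite /Rintegral fineK//; exact: integrable_fin_num.
move: hcvg; rewrite hE' => /fine_cvg; apply: cvg_trans; apply: near_eq_cvg.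
by apply: nearW => N; rewrite /= -intu.
Qed.

End integral_representation.

Section fractional_derivative.
Context {R : realType}.
Local Notation C := (R[i]).
Local Notation Re := (@complex.Re R).
Local Notation Im := (@complex.Im R).
Variable mu : {finite_measure set (measurableTypeR R) -> \bar R}.
Local Notation I01 := (`[0, 1[%classic : set (measurableTypeR R)).
Variable alpha : R.
Hypothesis halpha : -1 < alpha.
Local Notation b := (alpha + 1).

Let b0 : 0 < b. Proof. by rewrite -ltrBlDr sub0r. Qed.

Lemma radius_ge1_cst1 : radius_ge1 (fun=> 1 : R).
Proof.
move=> q /andP[q0 q1]; exists 1 => n.
by rewrite normr1 mul1r exprn_ile1// ltW.
Qed.

Lemma fracD_FmuE : fracD alpha (Fmu mu) =
  power_series (fun n => (negbin b n * moment mu n)%:C%C).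
Proof.
have rm : radius_ge1 (moment mu).
  have := radius_ge1_moment mu radius_ge1_cst1.
  by congr radius_ge1; apply/funext => n; rewrite mul1r.
rewrite /fracD /Fmu coefs_power_series//; congr power_series.
by apply/funext => n; rewrite -rmorphM /negbin addrA.
Qed.

Lemma radius_fracD : radius_ge1 (fun n => negbin b n * moment mu n).
Proof. exact: radius_ge1_moment (negbin_radius b0). Qed.

Lemma fracD_analytic : analytic_on_disc (fracD alpha (Fmu mu)).
Proof. by rewrite fracD_FmuE; exact: power_series_analytic radius_fracD. Qed.

(** With [kernel_angle], the polar form of [(1 - t z) ^ (- b)], the power being the one equal to 1
    at [t = 0]. *)
Definition kernel_modulus (z : C) (t : R) : R := modulus (1 - t%:C%C * z) `^ (- b).

Definition kernel_angle (z : C) (t : R) : R :=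
  b * atan (t * Im z / (1 - t * Re z)).

Lemma fracD_integral (z : C) : disc z ->
  [/\ mu.-integrable I01 (EFin \o (fun t => kernel_modulus z t * cos (kernel_angle z t))),
     Re (fracD alpha (Fmu mu) z) =
       \int[mu]_(t in I01) (kernel_modulus z t * cos (kernel_angle z t)),
     mu.-integrable I01 (EFin \o (fun t => kernel_modulus z t * sin (kernel_angle z t))) &
     Im (fracD alpha (Fmu mu) z) =
       \int[mu]_(t in I01) (kernel_modulus z t * sin (kernel_angle z t))].
Proof.
move=> z1; have z01 : 0 <= modulus z < 1 by rewrite modulus_ge0.
have tz (t : R) n : Re ((t%:C%C * z) ^+ n) = Re (z ^+ n) * t ^+ n /\
                    Im ((t%:C%C * z) ^+ n) = Im (z ^+ n) * t ^+ n.
  by rewrite exprMn -rmorphXn/= ReZ ImZ; split; exact: mulrC.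
have tz1 (t : R) : 0 <= t < 1 -> modulus (t%:C%C * z) < 1.
  move=> /andP[t0 t1]; rewrite modulusM modulus_real ger0_norm//.
  by rewrite (le_lt_trans _ z1)// ler_piMl ?modulus_ge0// ltW.
have Ek (t : R) : 0 <= t < 1 ->
  limn (series (fun n => negbin b n * (Re (z ^+ n) * t ^+ n))) =
    kernel_modulus z t * cos (kernel_angle z t) /\
  limn (series (fun n => negbin b n * (Im (z ^+ n) * t ^+ n))) =
    kernel_modulus z t * sin (kernel_angle z t).
  move=> t01; have [Er Ei] := negbin_series b0 (tz1 _ t01).
  rewrite ReZ ImZ in Er; rewrite ReZ ImZ in Ei.
  split; [apply: etrans Er|apply: etrans Ei]; congr (limn (series _));
    by apply/funext => n; rewrite ((tz _ _).1, (tz _ _).2).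
have [ir Er] := series_moment mu (negbin_radius b0) z01 (ReX_le z) (fun t t01 => (Ek t t01).1).
have [ii Ei] := series_moment mu (negbin_radius b0) z01 (ImX_le z) (fun t t01 => (Ek t t01).2).
by rewrite fracD_FmuE power_seriesE//; exact: radius_fracD.
Qed.

End fractional_derivative.

Section real_powers.
Context {R : realType}.
Implicit Types b u v : R.

Lemma powR_ge1 (a s : R) : 1 <= a -> 0 <= s -> 1 <= a `^ s.
Proof. by move=> a1 s0; rewrite -(powRr0 a); exact: ler_powR. Qed.

Lemma le_powRN b u v : 0 <= b -> 0 < u -> u <= v -> v `^ (- b) <= u `^ (- b).
Proof.
move=> b0 u0 uv; have v0 : 0 < v by rewrite (lt_le_trans u0).
rewrite !powRN lef_pV2 ?posrE ?powR_gt0//.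
by rewrite ge0_ler_powR ?nnegrE ?(ltW u0) ?(ltW v0).
Qed.

End real_powers.

(** * Integrals of truncated powers against a Carleson measure *)

Section carleson_estimates.
Context {R : realType}.
Local Notation C := (R[i]).
Local Notation Re := (@complex.Re R).
Local Notation Im := (@complex.Im R).
Variable mu : {finite_measure set (measurableTypeR R) -> \bar R}.
Local Notation I01 := (`[0, 1[%classic : set (measurableTypeR R)).
Implicit Types (s b r d t : R) (z : C).

Let mI : measurable I01. Proof. exact: measurable_itv. Qed.

Let mItv (i : interval R) : measurable ([set` i] : set (measurableTypeR R)).
Proof. exact: measurable_itv. Qed.

Lemma finite_measure_fin (A : set (measurableTypeR R)) : measurable A ->
  mu A = (fine (mu A))%:E.
Proof. by move=> mA; rewrite fineK// fin_num_measure. Qed.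

Lemma Rintegral_indic_itv (k : R) (i : interval R) :
  mu.-integrable I01 (EFin \o (fun t : R => k * \1_[set` i] t)) /\
  \int[mu]_(t in I01) (k * \1_[set` i] t) = k * fine (mu ([set` i] `&` I01)).
Proof.
have ii : mu.-integrable I01 (EFin \o \1_([set` i] : set (measurableTypeR R))).
  by apply: (integrableS _ _ (@subsetT _ _) (integrable_indic mu (mItv i))).
split; first exact: (integrableZl mI k ii).
by rewrite RintegralZl// /Rintegral/= integral_indic.
Qed.

(* Extends the Carleson condition to all [d > 0]: for [d >= 1] the total mass
   suffices. *)
Lemma carleson_tail s : 0 < s -> carleson s mu ->
  exists2 K : R, 0 <= K & forall d : R, 0 < d ->
    fine (mu ((`[1 - d, 1[%classic : set (measurableTypeR R)) `&` I01)) <= K * d `^ s.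
Proof.
move=> s0 [K0 K00 HK]; pose m := fine (mu I01).
have m0 : 0 <= m by rewrite fine_ge0.
exists (K0 + m); first by rewrite addr_ge0// ltW.
move=> d d0; have [d1|d1] := ltP d 1.
  have h := HK (1 - d) ltac:(by apply/andP; split; lra).
  rewrite subKr in h.
  apply: (@le_trans _ _ (K0 * d `^ s)); last by rewrite ler_wpM2r ?powR_ge0// lerDl.
  rewrite -lee_fin -finite_measure_fin; last exact: measurableI.
  apply: le_trans h; apply: le_measure; rewrite ?inE//; first exact: measurableI.
apply: (@le_trans _ _ m).
  apply: fine_le; rewrite ?fin_num_measure//; first exact: measurableI.
  by apply: le_measure; rewrite ?inE//; exact: measurableI.
rewrite -[leLHS]mulr1; apply: ler_pM => //; first by rewrite lerDr ltW.
by rewrite powR_ge1// ltW.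
Qed.

(** Majorant of [kernel_modulus] that depends on [z] only through [d = |1 - z| / 2]. *)
Definition trunc_pow (b d t : R) : R := (Num.max (1 - t) d) `^ (- b).

Lemma trunc_pow_integrable b d : 0 <= b -> 0 < d ->
  mu.-integrable I01 (EFin \o trunc_pow b d).
Proof.
move=> b0 d0; apply: (@bounded_integrable _ mu _ (d `^ (- b))).
  apply: (measurableT_comp (measurable_powR _)) => //.
  by apply: measurable_maxr => //; apply: measurable_funB.
move=> t _; rewrite ger0_norm ?powR_ge0//; apply: le_powRN => //.
by rewrite le_max lexx orbT.
Qed.

(* Doubling [d] costs at most the mass of [1 - 2 d, 1), so iterating sums a
   geometric series of ratio [2 `^ (s - b) < 1]. *)
Lemma carleson_trunc_pow s b : 0 < s < b -> carleson s mu ->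
  exists2 K : R, 0 <= K & forall d : R, 0 < d ->
    \int[mu]_(t in I01) trunc_pow b d t <= K * d `^ (s - b).
Proof.
move=> /andP[s0 sb] /(carleson_tail s0)[K0 K00 HK].
have b0 : 0 < b by rewrite (lt_trans s0).
pose m := fine (mu I01); have m0 : 0 <= m by rewrite fine_ge0.
pose q := (2 : R) `^ (s - b).
have q1 : q < 1.
  have l2 : 0 < ln (2 : R) by rewrite ln_gt0// ltr1n.
  have sb' : s - b < 0 by rewrite subr_lt0.
  by rewrite /q /powR pnatr_eq0/= -[ltRHS]expR0 ltr_expR pmulr_llt0.
(* The second summand solves [K q + K0 2 ^ s = K], the balance of one doubling step; [m] handles the
   base case [d >= 1]. *)
pose K := m + K0 * 2 `^ s / (1 - q).
have K1 : K0 * 2 `^ s <= K * (1 - q).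
  rewrite /K mulrDl divfK; first by rewrite lerDr mulr_ge0// subr_ge0 ltW.
  by rewrite subr_eq0 eq_sym lt_eqF.
have KK0 : 0 <= K.
  by rewrite addr_ge0// divr_ge0 ?subr_ge0 ?(ltW q1)// mulr_ge0 ?powR_ge0.
exists K => // d d0.
(* The induction runs on the number of doublings that bring [d] up to 1. *)
have [N HN] : exists N, 1 <= 2 ^+ N * d.
  exists (Num.trunc d^-1).+1; rewrite -ler_pdivrMr// mul1r.
  apply: le_trans (ltW (truncnS_gt _)) _.
  by rewrite -natrX ler_nat ltnW// ltn_expl.
elim: N d d0 HN => [|N IH] d d0 HN.
  rewrite expr0 mul1r in HN.
  apply: (@le_trans _ _ (\int[mu]_(t in I01) d `^ (- b))).
    apply: le_Rintegral => //.
    - exact: trunc_pow_integrable (ltW b0) d0.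
    - exact: finite_measure_integrable_cst.
    move=> t _; apply: le_powRN => //; first exact: ltW.
    by rewrite le_max lexx orbT.
  rewrite Rintegral_cst// mulrC.
  have -> : d `^ (s - b) = d `^ s * d `^ (- b) by rewrite powRD// (gt_eqF d0) implybT.
  rewrite mulrA ler_wpM2r ?powR_ge0// -[leLHS]mulr1; apply: ler_pM => //.
    by rewrite lerDl divr_ge0 ?subr_ge0 ?(ltW q1)// mulr_ge0 ?powR_ge0.
  by rewrite powR_ge1// ltW.
have d20 : 0 < 2 * d by rewrite mulr_gt0.
have IH2 : \int[mu]_(t in I01) trunc_pow b (2 * d) t <= K * (2 * d) `^ (s - b).
  by apply: IH => //; rewrite mulrA -exprSr.
have [ii iE] := Rintegral_indic_itv (d `^ (- b)) `[1 - 2 * d, 1[.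
have i2 := trunc_pow_integrable (ltW b0) d20.
apply: (@le_trans _ _ (\int[mu]_(t in I01) (trunc_pow b (2 * d) t + d `^ (- b) * \1_(`[1 - 2 * d, 1[%classic) t))).
  apply: le_Rintegral => //.
  - exact: trunc_pow_integrable (ltW b0) d0.
  - exact: (integrableD mI i2 ii).
  move=> t; rewrite /= in_itv/= => /andP[t0 t1]; rewrite /trunc_pow.
  (* Left of [1 - 2 d] both truncations are inactive and the integrands agree; to the right the
     single value [d ^ (- b)] is enough. *)
  have [tl|tl] := leP (1 - 2 * d) t.
    rewrite indicE mem_set/=; last by rewrite in_itv/= tl.
    rewrite mulr1 (@le_trans _ _ (d `^ (- b)))//; last by rewrite lerDr powR_ge0.
    by apply: le_powRN => //; [exact: ltW|rewrite le_max lexx orbT].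
  rewrite !max_l; [by rewrite lerDl mulr_ge0 ?powR_ge0//|lra|lra].
rewrite RintegralD// iE.
apply: (@le_trans _ _ (K * (2 * d) `^ (s - b) + d `^ (- b) * (K0 * (2 * d) `^ s))).
  by apply: lerD => //; rewrite ler_wpM2l ?powR_ge0// HK.
rewrite !powRM ?(ltW d0)// -/q.
have -> : d `^ (s - b) = d `^ s * d `^ (- b) by rewrite powRD// (gt_eqF d0) implybT.
rewrite -subr_ge0.
have -> : K * (d `^ s * d `^ (- b)) - (K * (q * (d `^ s * d `^ (- b))) + d `^ (- b) * (K0 * (2 `^ s * d `^ s)))
   = (K * (1 - q) - K0 * 2 `^ s) * (d `^ s * d `^ (- b)) by ring.
by rewrite mulr_ge0 ?subr_ge0// mulr_ge0 ?powR_ge0.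
Qed.

End carleson_estimates.

Section trigonometric_bounds.
Context {R : realType}.
Implicit Types x y : R.

Lemma lipschitz1_at0 (F dF : R -> R) (x : R) : (forall t : R, is_derive t 1 F (dF t)) ->
  (forall t, `|dF t| <= 1) -> `|F x - F 0| <= `|x|.
Proof.
move=> dFE dF1.
have cF (a c : R) : {within `[a, c], continuous F}.
  by apply: continuous_in_subspaceT => t _; exact: is_derive_continuous (dFE t).
have [x0|x0|->] := ltgtP x 0; last by rewrite subrr !normr0.
- have [t _ E] := MVT x0 (fun t _ => dFE t) (cF _ _).
  by rewrite distrC E sub0r normrM normrN ler_piMl.
- have [t _ E] := MVT x0 (fun t _ => dFE t) (cF _ _).
  by rewrite E subr0 normrM ler_piMl.
Qed.

Lemma norm_sin_le x : `|sin x| <= `|x|.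
Proof.
have := @lipschitz1_at0 sin cos x (fun t => is_derive_sin t) (@cos_max R).
by rewrite sin0 subr0.
Qed.

Lemma norm_cosB1_le x : `|cos x - 1| <= `|x|.
Proof.
have := @lipschitz1_at0 cos (fun t => - sin t) x (fun t => is_derive_cos t).
by rewrite cos0; apply => t; rewrite normrN sin_max.
Qed.

Lemma norm_atan_le x : `|atan x| <= `|x|.
Proof.
have := @lipschitz1_at0 atan (fun t => (1 + t ^+ 2)^-1) x (fun t => is_derive1_atan t).
rewrite atan0 subr0; apply => t.
have t0 : 1 <= 1 + t ^+ 2 by rewrite lerDl sqr_ge0.
have t1 : 0 < 1 + t ^+ 2 by rewrite (lt_le_trans _ t0).
by rewrite ger0_norm ?invr_ge0 ?(ltW t1)// invf_le1.
Qed.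

Lemma cos_half_gt0 : 0 < cos 2^-1 :> R.
Proof.
apply: cos_gt0_pihalf; have := pi_ge2 R => h.
have -> : 2^-1 = 1 / 2 :> R by rewrite mul1r.
by apply/andP; split; lra.
Qed.

Lemma cos_ge_half x : `|x| <= 2^-1 -> cos 2^-1 <= cos x.
Proof.
move=> x1; rewrite -(cos_norm x); move: x1; rewrite le_eqVlt => /predU1P[->//|x1].
have h := pi_ge2 R; have x0 : 0 <= `|x| by [].
have h2 : 2^-1 = 1 / 2 :> R by rewrite mul1r.
apply: ltW; rewrite ltr_cos// in_itv/=; apply/andP; split; lra.
Qed.

End trigonometric_bounds.

(** * Pointwise bounds for the fractional derivative *)

Section pointwise_bounds.
Context {R : realType}.
Local Notation C := (R[i]).
Local Notation Re := (@complex.Re R).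
Local Notation Im := (@complex.Im R).
Variable mu : {finite_measure set (measurableTypeR R) -> \bar R}.
Local Notation I01 := (`[0, 1[%classic : set (measurableTypeR R)).
Variable alpha : R.
Hypothesis halpha : -1 < alpha.
Local Notation b := (alpha + 1).
Local Notation f := (fracD alpha (Fmu mu)).

Let b0 : 0 < b. Proof. by rewrite -ltrBlDr sub0r. Qed.

Let mI : measurable I01. Proof. exact: measurable_itv. Qed.

(* [1 - z = (1 - t z) - (1 - t) z] and [1 - t <= |1 - t z|]. *)
Lemma modulus_1BtM_ge (z : C) (t : R) : disc z -> 0 <= t < 1 ->
  Num.max (1 - t) (modulus (1 - z) / 2) <= modulus (1 - t%:C%C * z).
Proof.
move=> z1 /andP[t0 t1].
have mtz : modulus (t%:C%C * z) <= t.
  by rewrite modulusM modulus_real ger0_norm// ler_piMr// ltW.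
have h1 : 1 - t <= modulus (1 - t%:C%C * z).
  have := modulusD (1 - t%:C%C * z) (t%:C%C * z); rewrite subrK.
  by rewrite modulus1; move: mtz; lra.
rewrite ge_max h1/= ler_pdivrMr//.
have -> : 1 - z = (1 - t%:C%C * z) + (- (1 - t)%:C%C * z).
  by rewrite rmorphB/=; ring.
apply: le_trans (modulusD _ _) _.
have : modulus (- (1 - t)%:C%C * z) <= 1 - t.
  rewrite mulNr modulusN modulusM modulus_real ger0_norm ?subr_ge0 ?(ltW t1)//.
  by rewrite ler_piMr ?subr_ge0 ?(ltW t1)// ltW.
by lra.
Qed.

Lemma modulus_1B_gt0 (z : C) : disc z -> 0 < modulus (1 - z).
Proof.
move=> z1; rewrite lt_def modulus_ge0 andbT modulus_eq0 subr_eq0.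
by apply/eqP => zE; move: z1; rewrite discE -zE modulus1 ltxx.
Qed.

Lemma fracD_upper (s : R) : 0 < s < b -> carleson s mu ->
  exists2 K : R, 0 <= K &
    forall z : C, disc z -> modulus (f z) <= K * modulus (1 - z) `^ (s - b).
Proof.
move=> sb /(carleson_trunc_pow sb)[K K0 HK].
(* The factor 2 comes from bounding real and imaginary parts separately, the power of [1 / 2] from
   [d = |1 - z| / 2]. *)
exists (2 * K * 2^-1 `^ (s - b)); first by rewrite !mulr_ge0 ?powR_ge0.
move=> z z1; have dz := modulus_1B_gt0 z1.
pose d := modulus (1 - z) / 2; have d0 : 0 < d by rewrite divr_gt0.
have it := trunc_pow_integrable mu (ltW b0) d0.
have [ir Er ii Ei] := fracD_integral mu halpha z1.
have kle (t : R) : I01 t -> kernel_modulus alpha z t <= trunc_pow b d t.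
  rewrite /= in_itv/= => t01; apply: le_powRN; first exact: ltW.
    by rewrite lt_max d0 orbT.
  exact: modulus_1BtM_ge.
have bound (g : R -> R) : (forall t, `|g t| <= 1) ->
    mu.-integrable I01 (EFin \o (fun t => kernel_modulus alpha z t * g t)) ->
    `|\int[mu]_(t in I01) (kernel_modulus alpha z t * g t)| <= K * d `^ (s - b).
  move=> g1 ig; apply: le_trans (le_normr_Rintegral mI ig) _.
  apply: le_trans (HK _ d0); apply: le_Rintegral => //.
    exact: (integrable_abse ig).
  move=> t t01; rewrite normrM (ger0_norm (powR_ge0 _ _)).
  by apply: le_trans (kle _ t01); rewrite ler_piMr ?powR_ge0.
apply: le_trans (modulus_le_ReIm _) _.
rewrite Er Ei; apply: le_trans (lerD (bound _ _ ir) (bound _ _ ii)) _.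
- by move=> t; exact: cos_max.
- by move=> t; exact: sin_max.
rewrite /d powRM ?modulus_ge0 ?invr_ge0//.
by rewrite le_eqVlt; apply/orP; left; apply/eqP; ring.
Qed.

Lemma modulus_cis (r theta : R) : 0 <= r -> modulus (cis r theta) = r.
Proof.
move=> r0; rewrite modulusE/= !exprMn -mulrDr cos2Dsin2 mulr1.
by rewrite sqrtr_sqr ger0_norm.
Qed.

Lemma disc_cis (r theta : R) : 0 <= r < 1 -> disc (cis r theta).
Proof. by move=> /andP[r0 r1]; rewrite discE modulus_cis. Qed.

(* On the arc [0 <= theta <= e (1 - r)] the kernel [(1 - t z) ^ (- b)] has
   argument at most [1 / 2], hence a real part comparable to its modulus. *)
Lemma fracD_lower : exists e k : R, [/\ 0 < e <= 1, 0 < k &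
  forall r theta : R, 0 < r < 1 -> 0 <= theta <= e * (1 - r) ->
    k * (1 - r) `^ (- b) * fine (mu `[r, 1[%classic) <= modulus (f (cis r theta))].
Proof.
(* The angle is at most [b * theta / (1 - r) <= b * e <= 1 / 2]; the bound [e <= 1] gives
   [theta <= 1 - r], used in [mod4]. *)
pose e := Num.min 1 (2 * b)^-1.
have b20 : 0 < 2 * b by rewrite mulr_gt0.
have e0 : 0 < e by rewrite lt_min ltr01/= invr_gt0.
have e1 : e <= 1 by rewrite ge_min lexx.
have eb : b * e <= 2^-1.
  rewrite -ler_pdivlMl// (le_trans (_ : _ <= (2 * b)^-1)) ?ge_min ?lexx ?orbT//.
  by rewrite invfM mulrC.
exists e, (cos 2^-1 * 4 `^ (- b)); split; first by rewrite e0.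
  by rewrite mulr_gt0 ?cos_half_gt0 ?powR_gt0.
move=> r theta /andP[r0 r1] /andP[th0 the].
have r10 : 0 < 1 - r by rewrite subr_gt0.
have th1 : theta <= 1 - r by rewrite (le_trans the)// ler_piMl// ltW.
set z := cis r theta.
have z1 : disc z by apply: disc_cis; rewrite (ltW r0).
have [ir Er _ _] := fracD_integral mu halpha z1.
apply: le_trans (Re_le_modulus _); apply: le_trans (ler_norm _); rewrite Er.
have RezE : Re z = r * cos theta by [].
have ImzE : Im z = r * sin theta by [].
have angle (t : R) : 0 <= t < 1 -> cos 2^-1 <= cos (kernel_angle alpha z t).
  move=> /andP[t0 t1]; apply: cos_ge_half; rewrite /kernel_angle normrM (gtr0_norm b0).
  apply: le_trans eb; rewrite ler_pM2l//; apply: le_trans (norm_atan_le _) _.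
  have tr1 : 1 - r <= 1 - t * Re z.
    rewrite lerB// RezE mulrCA ler_piMr ?(ltW r0)//.
    rewrite (le_trans (ler_norm _))// normrM ger0_norm//.
    by rewrite -[leRHS]mulr1; apply: ler_pM => //; [exact: ltW|exact: cos_max].
  have tr0 : 0 < 1 - t * Re z by rewrite (lt_le_trans r10).
  rewrite normrM normfV (gtr0_norm tr0) ler_pdivrMr//.
  apply: (@le_trans _ _ (e * (1 - r))); last by rewrite ler_wpM2l// ltW.
  apply: le_trans the; rewrite ImzE !normrM (ger0_norm t0) (gtr0_norm r0).
  rewrite mulrA; apply: (@le_trans _ _ `|sin theta|).
    by rewrite ler_piMl// (mulr_ile1 t0 (ltW r0) (ltW t1) (ltW r1)).
  by apply: le_trans (norm_sin_le _) _; rewrite ger0_norm.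
(* The 4 is 2 + 1 + 1: [1 - t r <= 2 (1 - r)] because [t >= r], and the terms in [cos theta - 1] and
   [sin theta] are each at most [theta <= 1 - r]. *)
have mod4 (t : R) : r <= t < 1 -> modulus (1 - t%:C%C * z) <= 4 * (1 - r).
  move=> /andP[rt t1]; have t0 : 0 <= t by rewrite (le_trans (ltW r0)).
  apply: le_trans (modulus_le_ReIm _) _.
  have -> : Re (1 - t%:C%C * z) = (1 - t * r) - t * r * (cos theta - 1).
    by rewrite /z /cis /=; ring.
  have -> : Im (1 - t%:C%C * z) = - (t * r * sin theta).
    by rewrite /z /cis /=; ring.
  have tr01 : 0 <= t * r <= 1 by rewrite mulr_ge0 ?(ltW r0)//= (mulr_ile1 t0 (ltW r0) (ltW t1) (ltW r1)).
  have [tr0 tr1] := andP tr01.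
  have trl : 0 <= 1 - t * r <= 2 * (1 - r).
    rewrite subr_ge0 tr1/= -subr_ge0.
    have -> : 2 * (1 - r) - (1 - t * r) = (1 - r) ^+ 2 + r * (t - r) by ring.
    by rewrite addr_ge0 ?sqr_ge0// mulr_ge0 ?subr_ge0// ltW.
  have sm (g : R) : `|g| <= theta -> `|t * r * g| <= 1 - r.
    move=> gth; apply: le_trans th1; apply: le_trans gth.
    by rewrite normrM ler_piMl// ger0_norm.
  have cb : `|cos theta - 1| <= theta by apply: le_trans (norm_cosB1_le _) _; rewrite ger0_norm.
  have sb : `|sin theta| <= theta by apply: le_trans (norm_sin_le _) _; rewrite ger0_norm.
  rewrite normrN; apply: le_trans (lerD (ler_normB _ _) (sm _ sb)) _.
  have := sm _ cb; have [tl0 tl] := andP trl; rewrite (ger0_norm tl0).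
  by lra.
(* The mass on [[0, r)] can be discarded: [angle] holds on all of [[0, 1)], so the integrand is
   nonnegative there. *)
have [ii iE] := Rintegral_indic_itv mu (cos 2^-1 * 4 `^ (- b) * (1 - r) `^ (- b)) `[r, 1[.
have subI : (`[r, 1[%classic : set (measurableTypeR R)) `&` I01 = `[r, 1[%classic.
  apply: setIidl => t; rewrite /= !in_itv/= => /andP[rt ->].
  by rewrite (le_trans (ltW r0)).
rewrite subI in iE; rewrite -iE; apply: le_Rintegral => //.
move=> t It; have t01 : 0 <= t < 1 by move: It; rewrite /= in_itv.
have kc : 0 <= cos (kernel_angle alpha z t).
  by rewrite (le_trans _ (angle _ t01))// ltW// cos_half_gt0.
rewrite indicE; have [|_] := boolP (t \in _); last by rewrite mulr0 mulr_ge0 ?powR_ge0.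
rewrite inE/= in_itv/= => rt; rewrite mulr1 -mulrA [leRHS]mulrC.
have u0 : 0 < modulus (1 - t%:C%C * z).
  have [_ t1] := andP t01.
  by rewrite (lt_le_trans _ (modulus_1BtM_ge z1 t01))// lt_max subr_gt0 t1.
rewrite -powRM ?(ltW r10)//; apply: ler_pM.
- by rewrite ltW// cos_half_gt0.
- exact: powR_ge0.
- exact: angle.
- by apply: le_powRN => //; [exact: ltW|exact: mod4].
Qed.

End pointwise_bounds.

(** * Growth of the means *)

Section circle_means.
Context {R : realType}.
Local Notation C := (R[i]).
Local Notation Re := (@complex.Re R).
Local Notation Im := (@complex.Im R).
Notation leb := (@lebesgue_measure R).
Implicit Types (r theta : R).

Lemma Re_1Bcis r theta : Re (1 - cis r theta) = 1 - r * cos theta.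
Proof. by []. Qed.

Lemma Im_1Bcis r theta : Im (1 - cis r theta) = - (r * sin theta).
Proof. by rewrite /= sub0r. Qed.

Lemma modulus_1B_ge (z : C) : 1 - modulus z <= modulus (1 - z).
Proof.
have := modulusD (1 - z) z; rewrite subrK modulus1; lra.
Qed.

(** [|sin theta|] is the distance from 1 to the line through 0 and [cis 1 theta], which contains
    [cis r theta]. *)
Lemma modulus_1Bcis_ge_sin r theta : `|sin theta| <= modulus (1 - cis r theta).
Proof.
rewrite modulusE Re_1Bcis Im_1Bcis -sqrtr_sqr ler_wsqrtr//.
have -> : (1 - r * cos theta) ^+ 2 + (- (r * sin theta)) ^+ 2 =
   (cos theta - r) ^+ 2 + sin theta ^+ 2 + (1 - r ^+ 2) * (1 - (cos theta ^+ 2 + sin theta ^+ 2)) by ring.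
by rewrite cos2Dsin2 subrr mulr0 addr0 lerDr sqr_ge0.
Qed.

(* [cos + sin >= 1] on the first quadrant. *)
Lemma sinB_cos_ge theta : 0 <= theta <= pi / 2 -> theta <= sin theta + 1 - cos theta.
Proof.
move=> /andP[]; rewrite le_eqVlt => /predU1P[<- _|t0 t1].
  by rewrite sin0 cos0 add0r subrr.
have dg (t : R) : is_derive t 1 (fun t => sin t - cos t) (cos t + sin t).
  apply: is_derive_congr (is_deriveB (is_derive_sin t) (is_derive_cos t)) _ _ => //.
  by rewrite opprK.
have [|t] := @MVT R (fun t => sin t - cos t) (fun t => cos t + sin t) 0 theta t0 (fun t _ => dg t).
  by apply: continuous_in_subspaceT => t _; exact: is_derive_continuous (dg t).
rewrite in_itv/= sin0 cos0 sub0r opprK subr0 => /andP[tt0 tt1] E.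
have c0 : 0 <= cos t.
  by apply: cos_ge0_pihalf; rewrite (ltW (le_lt_trans _ tt0)) ?oppr_le0 ?divr_ge0 ?pi_ge0//= (le_trans (ltW tt1)).
have s0 : 0 <= sin t.
  apply: sin_ge0_pi; rewrite (ltW tt0)/= (le_trans (ltW tt1))// (le_trans t1)//.
  by rewrite ler_pdivrMr// ler_peMr ?pi_ge0// ler1n.
have cs1 : 1 <= cos t + sin t.
  have h : 1 <= (cos t + sin t) ^+ 2.
    by rewrite sqrrD -[X in X <= _](cos2Dsin2 t) addrAC lerDl mulrn_wge0// mulr_ge0.
  by move: h; rewrite -{1}(expr1n R 2) ler_sqr ?nnegrE ?addr_ge0.
have : theta <= (cos t + sin t) * theta by rewrite ler_peMl// ltW.
by rewrite -E; lra.
Qed.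

(** Write [M] for the modulus. Up to [pi / 2], [sinB_cos_ge] gives even [3 M]. Beyond,
    [cos theta <= 0] forces [M >= 1], so [theta <= pi < 4] costs [4 M] and [1 - r] one more. *)
Lemma modulus_1Bcis_ge r theta : 0 < r < 1 -> 0 <= theta <= pi ->
  (1 - r) + theta <= 5 * modulus (1 - cis r theta).
Proof.
move=> /andP[r0 r1] /andP[t0 tpi].
have m1 : 1 - r <= modulus (1 - cis r theta).
  by apply: le_trans (modulus_1B_ge _); rewrite modulus_cis// ltW.
have mre : 1 - r * cos theta <= modulus (1 - cis r theta).
  by apply: le_trans (Re_le_modulus _); rewrite Re_1Bcis ler_norm.
have msin := modulus_1Bcis_ge_sin r theta.
have pi4 : pi < 4 :> R by have := pihalf_lt2 R; rewrite ltr_pdivrMr//; lra.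
have [th|th] := leP theta (pi / 2).
  have g := @sinB_cos_ge theta ltac:(by rewrite t0).
  have c0 : 0 <= cos theta.
    by apply: cos_ge0_pihalf; rewrite th andbT (le_trans _ t0)// oppr_le0 divr_ge0 ?pi_ge0.
  have rc : r * cos theta <= cos theta by rewrite ler_piMl// ltW.
  have := ler_norm (sin theta); lra.
have c0 : cos theta <= 0.
  rewrite -oppr_ge0 -sinBpihalf; apply: sin_ge0_pi.
  rewrite subr_ge0 ltW//= lerBlDr (le_trans tpi)// lerDl divr_ge0 ?pi_ge0//.
have rc : r * cos theta <= 0 by rewrite mulr_ge0_le0// ltW.
by lra.
Qed.

Lemma modulus_1Bcis_sym r theta :
  modulus (1 - cis r (2 * pi - theta)) = modulus (1 - cis r theta).
Proof.
have E : 2 * pi - theta = - theta + pi *+ 2 by rewrite mulr_natl addrC.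
by rewrite !modulusE !Re_1Bcis !Im_1Bcis E cosD2pi sinD2pi cosN sinN mulrN opprK sqrrN.
Qed.

(** On [[0, 2 pi]] the circle comes close to 1 at both ends, hence one term for each. *)
Lemma modulus_1Bcis_powRN_le (k r theta : R) : 0 < k -> 0 < r < 1 -> 0 <= theta <= 2 * pi ->
  modulus (1 - cis r theta) `^ (- k) <=
  5 `^ k * ((1 - r + theta) `^ (- k) + (1 - r + (2 * pi - theta)) `^ (- k)).
Proof.
move=> k0 r01 /andP[t0 t2]; have [r0 r1] := andP r01.
have key (u : R) : 0 <= u -> (1 - r) + u <= 5 * modulus (1 - cis r theta) ->
    modulus (1 - cis r theta) `^ (- k) <= 5 `^ k * (1 - r + u) `^ (- k).
  move=> u0 h; have ru : 0 < 1 - r + u by rewrite ltr_wpDr// subr_gt0.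
  have := le_powRN (ltW k0) ru h.
  rewrite powRM ?modulus_ge0// powRN => h'.
  by rewrite -ler_pdivrMl ?powR_gt0.
have [tp|tp] := leP theta pi.
  apply: le_trans (key theta t0 _) _; first by apply: modulus_1Bcis_ge => //; rewrite t0.
  by rewrite ler_wpM2l ?powR_ge0// lerDl powR_ge0.
apply: le_trans (key (2 * pi - theta) _ _) _; first by rewrite subr_ge0.
  rewrite -modulus_1Bcis_sym; apply: modulus_1Bcis_ge => //.
  by rewrite subr_ge0 t2/=; lra.
by rewrite ler_wpM2l ?powR_ge0// lerDr powR_ge0.
Qed.

(** The exponent is below -1, so explicit primitives give a bound independent of [L]; the second
    integral is the reflection of the first. *)
Lemma integral_powRN_le (d q L : R) : 0 < d -> 0 < q -> 0 < L ->
  (\int[leb]_(t in `[0%R, L]) ((d + t) `^ (- (1 + q)))%:E <= (d `^ (- q) / q)%:E)%E /\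
  (\int[leb]_(t in `[0%R, L]) ((d + (L - t)) `^ (- (1 + q)))%:E <= (d `^ (- q) / q)%:E)%E.
Proof.
move=> d0 q0 L0; have E : - q - 1 = - (1 + q) by ring.
have du (t : R) : is_derive t 1 (fun t => d + t) 1.
  by apply: is_derive_congr (is_deriveD (is_derive_cst d t (1 : R)) (is_derive_id t (1 : R))) _ _ => //; rewrite add0r.
have dv (t : R) : is_derive t 1 (fun t => d + (L - t)) (-1).
  apply: is_derive_congr (is_deriveD (is_derive_cst d t (1 : R)) (is_deriveB (is_derive_cst L t (1 : R)) (is_derive_id t (1 : R)))) _ _ => //.
  by rewrite add0r sub0r.
have u0 (t : R) : 0 <= t <= L -> 0 < d + t by move=> /andP[? _]; rewrite ltr_wpDr.
have v0 (t : R) : 0 <= t <= L -> 0 < d + (L - t) by move=> /andP[_ ?]; rewrite ltr_wpDr// subr_ge0.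
have q0' : q != 0 by rewrite gt_eqF.
have dscale (F : R -> R) (c t e : R) : is_derive t 1 F e -> is_derive t 1 (fun t => c * F t) (c * e).
  move=> dF; apply: is_derive_congr (is_deriveM (is_derive_cst c t (1 : R)) dF) _ _ => //.
  by rewrite /GRing.scale/= mulr0 addr0.
split.
- have D (t : R) : 0 <= t <= L ->
      is_derive t 1 (fun t => - q^-1 * (d + t) `^ (- q)) ((d + t) `^ (- (1 + q))).
    move=> t0; apply: is_derive_congr (dscale _ (- q^-1) _ _ (is_derive_powR_comp (- q) (u0 _ t0) (du t))) _ _ => //.
    by rewrite E; field.
  have cD (t : R) : 0 <= t <= L -> {for t, continuous (fun t => (d + t) `^ (- (1 + q)))}.
    by move=> t0; exact: is_derive_continuous (is_derive_powR_comp (- (1 + q)) (u0 _ t0) (du t)).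
  rewrite (integral_is_derive L0 D cD) lee_fin addr0 -subr_ge0.
  have -> : d `^ (- q) / q - (- q^-1 * (d + L) `^ (- q) - - q^-1 * d `^ (- q)) =
    (d + L) `^ (- q) / q by ring.
  by rewrite divr_ge0 ?powR_ge0// ltW.
- have D (t : R) : 0 <= t <= L ->
      is_derive t 1 (fun t => q^-1 * (d + (L - t)) `^ (- q)) ((d + (L - t)) `^ (- (1 + q))).
    move=> t0; apply: is_derive_congr (dscale _ q^-1 _ _ (is_derive_powR_comp (u := fun t : R => d + (L - t)) (- q) (v0 _ t0) (dv t))) _ _ => //.
    by rewrite E; field.
  have cD (t : R) : 0 <= t <= L -> {for t, continuous (fun t => (d + (L - t)) `^ (- (1 + q)))}.
    by move=> t0; exact: is_derive_continuous (is_derive_powR_comp (u := fun t : R => d + (L - t)) (- (1 + q)) (v0 _ t0) (dv t)).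
  rewrite (integral_is_derive L0 D cD) lee_fin subrr subr0 addr0 -subr_ge0.
  have -> : d `^ (- q) / q - (q^-1 * d `^ (- q) - q^-1 * (d + L) `^ (- q)) =
    (d + L) `^ (- q) / q by ring.
  by rewrite divr_ge0 ?powR_ge0// ltW.
Qed.

Lemma measurable_cis_expr r n :
  measurable_fun setT (fun t : R => Re (cis r t ^+ n)) /\
  measurable_fun setT (fun t : R => Im (cis r t ^+ n)).
Proof.
have mc : measurable_fun setT (fun t : R => Re (cis r t)).
  by apply: measurable_funM => //; apply: continuous_measurable_fun; exact: continuous_cos.
have ms : measurable_fun setT (fun t : R => Im (cis r t)).
  by apply: measurable_funM => //; apply: continuous_measurable_fun; exact: continuous_sin.
elim: n => [|n [IHc IHs]].
  by split; under eq_fun do rewrite expr0; exact: measurable_cst.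
split.
  under eq_fun do rewrite ReS.
  by apply: measurable_funB; apply: measurable_funM.
under eq_fun do rewrite ImS.
by apply: measurable_funD; apply: measurable_funM.
Qed.

(** On a circle both parts of the function are pointwise limits of trigonometric polynomials. *)
Lemma measurable_modulus_circle (a : nat -> R) r : radius_ge1 a -> 0 < r < 1 ->
  measurable_fun setT (fun t : R => modulus (power_series (fun n => (a n)%:C%C) (cis r t))).
Proof.
move=> ra /andP[r0 r1].
have d1 (t : R) : disc (cis r t) by apply: disc_cis; rewrite (ltW r0).
have mz (t : R) : 0 <= modulus (cis r t) < 1 by rewrite modulus_ge0; exact: d1.
have mre : measurable_fun setT (fun t : R => Re (power_series (fun n => (a n)%:C%C) (cis r t))).
  apply: (@measurable_fun_cvg _ _ _ _ (fun N t => series (fun n => a n * Re (cis r t ^+ n)) N)).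
    have mt n : measurable_fun setT (fun t : R => a n * Re (cis r t ^+ n)).
      by apply: measurable_funM => //; exact: (measurable_cis_expr r n).1.
    by move=> N; exact: (measurable_sum _ mt).
  by move=> t _; rewrite power_seriesE//; exact: radius_ge1_cvg ra (mz t) (ReX_le _).
have mim : measurable_fun setT (fun t : R => Im (power_series (fun n => (a n)%:C%C) (cis r t))).
  apply: (@measurable_fun_cvg _ _ _ _ (fun N t => series (fun n => a n * Im (cis r t ^+ n)) N)).
    have mt n : measurable_fun setT (fun t : R => a n * Im (cis r t ^+ n)).
      by apply: measurable_funM => //; exact: (measurable_cis_expr r n).2.
    by move=> N; exact: (measurable_sum _ mt).
  by move=> t _; rewrite power_seriesE//; exact: radius_ge1_cvg ra (mz t) (ImX_le _).
under eq_fun do rewrite modulusE -powR12_sqrt ?addr_ge0 ?sqr_ge0//.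
apply: (measurableT_comp (measurable_powR _)) => //.
by apply: measurable_funD; exact: measurable_funX.
Qed.

End circle_means.

(** * Carleson condition and growth spaces *)

Section growth_spaces.
Context {R : realType}.
Local Notation C := (R[i]).
Notation leb := (@lebesgue_measure R).
Variable mu : {finite_measure set (measurableTypeR R) -> \bar R}.
Local Notation I01 := (`[0, 1[%classic : set (measurableTypeR R)).
Variable alpha : R.
Hypothesis halpha : -1 < alpha.
Local Notation b := (alpha + 1).
Local Notation f := (fracD alpha (Fmu mu)).

Lemma HspaceP (p : \bar R) (gamma : R) (g : C -> C) : analytic_on_disc g ->
  Hspace p gamma g <-> exists M : R, forall r : R, 0 < r < 1 ->
    (((1 - r) `^ gamma)%:E * Mean p g r <= M%:E)%E.
Proof.
move=> ag; split=> [[_]|[M HM]].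
  rewrite /Hnorm; set S := [set _ | _ in _] => Hlt.
  have le (r : R) : 0 < r < 1 -> (((1 - r) `^ gamma)%:E * Mean p g r <= ereal_sup S)%E.
    by move=> r01; apply: ereal_sup_ubound; exists r => //=; rewrite in_itv.
  move: Hlt le; case: (ereal_sup S) => [M _ HM|//|_ HM]; first by exists M.
  (* If the supremum is [-oo], any real number is a bound. *)
  by exists 0 => r r01; apply: le_trans (HM r r01) _; rewrite leNye.
split=> //; apply: (@le_lt_trans _ _ M%:E); last exact: ltry.
by apply: ub_ereal_sup => _ [r /= r01 <-]; apply: HM; move: r01; rewrite in_itv.
Qed.

(** The sign of [M] is unknown, and [carleson] asks for a strictly positive constant; hence [|M|]
    and the added 1. *)
Lemma carleson_of_bound (s c M : R) : 0 < c ->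
  (forall r : R, 0 < r < 1 -> c * fine (mu `[r, 1[%classic) <= M * (1 - r) `^ s) ->
  carleson s mu.
Proof.
move=> c0 H; exists (`|M| / c + 1); first by rewrite ltr_wpDl// divr_ge0// ltW.
move=> r r01; rewrite finite_measure_fin; last exact: measurable_itv.
rewrite lee_fin; apply: (@le_trans _ _ (`|M| / c * (1 - r) `^ s)).
  rewrite mulrAC ler_pdivlMr// mulrC; apply: le_trans (H r r01) _.
  by rewrite ler_wpM2r ?powR_ge0// ler_norm.
by rewrite ler_wpM2r ?powR_ge0// lerDl.
Qed.

Lemma powRN_mul_le (x t A M : R) : 0 < x -> x `^ (- t) * A <= M -> A <= M * x `^ t.
Proof. by move=> x0; rewrite powRN mulrC ler_pdivrMr ?powR_gt0. Qed.

Lemma onemr_gt0 (r : R) : 0 < r < 1 -> 0 < 1 - r.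
Proof. by move=> /andP[_ r1]; rewrite subr_gt0. Qed.

Lemma carleson_Agrowth (s gamma : R) : 0 < s -> 0 < gamma -> s = b - gamma ->
  carleson s mu <-> Agrowth gamma f.
Proof.
move=> s0 g0 sE; rewrite /Agrowth (HspaceP _ _ (fracD_analytic (mu := mu) halpha)); split.
  have sb : 0 < s < b by rewrite s0 sE; lra.
  move=> /(fracD_upper halpha sb)[K K0 HK]; exists K => r r01.
  have r1 := onemr_gt0 r01.
  apply: (@le_trans _ _ (((1 - r) `^ gamma)%:E * (K * (1 - r) `^ (- gamma))%:E)%E).
    rewrite lee_wpmul2l ?lee_fin ?powR_ge0//= ; apply: ub_ereal_sup => _ [z /= zr <-].
    have z1 : disc z by rewrite discE zr; case/andP: r01.
    rewrite lee_fin; apply: le_trans (HK z z1) _; rewrite ler_wpM2l//.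
    have -> : s - b = - gamma by rewrite sE; ring.
    by apply: le_powRN; rewrite ?(ltW g0)// -zr modulus_1B_ge.
  by rewrite -EFinM lee_fin powRN mulrCA mulfV ?mulr1// gt_eqF ?powR_gt0.
move=> [M HM]; have [e [k [/andP[e0 _] k0 Hk]]] := fracD_lower mu halpha.
apply: (carleson_of_bound (M := M) k0) => r r01.
have r1 := onemr_gt0 r01; have [r0 _] := andP r01.
(* For the supremum a single point of the arc suffices, namely [theta = 0]. *)
have low : k * (1 - r) `^ (- b) * fine (mu `[r, 1[%classic) <= modulus (f (cis r 0)).
  by apply: Hk => //; rewrite lexx mulr_ge0// ltW.
have up : (1 - r) `^ gamma * modulus (f (cis r 0)) <= M.
  rewrite -lee_fin EFinM; apply: le_trans (HM r r01).
  rewrite lee_wpmul2l ?lee_fin ?powR_ge0//=; apply: ereal_sup_ubound.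
  by exists (cis r 0) => //; apply: modulus_cis; exact: ltW.
apply: powRN_mul_le => //; apply: le_trans up; apply: le_trans (ler_wpM2l (powR_ge0 (1 - r) gamma) low).
have -> : - s = gamma + - b by rewrite sE; ring.
rewrite powRD; last by rewrite (gt_eqF r1) implybT.
by rewrite le_eqVlt; apply/orP; left; apply/eqP; ring.
Qed.

(** Keep only an arc of length [e] in the mean. The lemma is applied with an arc proportional to
    [1 - r], whose length produces the factor [(1 - r) ^ (1 / p)]. *)
Lemma Mean_EFin_ge (p r e c : R) : 0 < p -> 0 <= e <= 2 * pi -> 0 <= c -> 0 < r < 1 ->
  (forall theta : R, 0 <= theta <= e -> c <= modulus (f (cis r theta))) ->
  ((((2 * pi)^-1 * e) `^ p^-1 * c)%:E <= Mean p%:E f r)%E.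
Proof.
move=> p0 /andP[e0 e2] c0 r01 H.
have pi20 : 0 < 2 * pi :> R by rewrite mulr_gt0 ?pi_gt0.
have mf : measurable_fun setT (fun t : R => modulus (f (cis r t))).
  by rewrite fracD_FmuE; exact: measurable_modulus_circle (radius_fracD _ halpha) r01.
have mfp : measurable_fun setT (fun t : R => (modulus (f (cis r t)) `^ p)%:E).
  by apply/measurable_EFinP; exact: (measurableT_comp (measurable_powR _)).
have step : ((c `^ p * e)%:E <= \int[leb]_(t in `[0%R, (2 * pi)%R]) (modulus (f (cis r t)) `^ p)%:E)%E.
  apply: (@le_trans _ _ (\int[leb]_(t in `[0%R, e]) (modulus (f (cis r t)) `^ p)%:E)%E); last first.
    apply: ge0_subset_integral; [exact: measurable_itv|exact: measurable_itv| | |].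
    - exact: measurable_funS mfp.
    - by move=> t _; rewrite lee_fin powR_ge0.
    - by apply: subset_itvl; rewrite bnd_simp.
  apply: (@le_trans _ _ (\int[leb]_(t in `[0%R, e]) (c `^ p)%:E)%E).
    rewrite integral_cst//= lebesgue_measure_itv/= lte_fin.
    have [e0'|e0'] := ltP 0 e; first by rewrite -EFinB -EFinM subr0.
    by rewrite (_ : e = 0) ?mulr0 ?mule0//; apply/eqP; rewrite eq_le e0 e0'.
  apply: ge0_le_integral => //.
  - by move=> t _; rewrite lee_fin powR_ge0.
  - exact: measurable_funS mfp.
  - move=> t; rewrite /= in_itv/= => t0; rewrite lee_fin.
    by apply: ge0_ler_powR; rewrite ?nnegrE ?(ltW p0) ?modulus_ge0// H.
have cE : ((2 * pi)^-1 * e) `^ p^-1 * c = ((2 * pi)^-1 * (c `^ p * e)) `^ p^-1.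
  rewrite mulrCA [RHS]powRM ?powR_ge0//; last by rewrite mulr_ge0// invr_ge0 ltW.
  by rewrite -powRrM mulfV ?gt_eqF// powRr1// mulrC.
rewrite cE -poweR_EFin EFinM /Mean; apply: gt0_ler_poweR.
- by rewrite invr_ge0 ltW.
- by rewrite in_itv/= leey andbT -EFinM lee_fin !mulr_ge0 ?powR_ge0// invr_ge0 ltW.
- rewrite in_itv/= leey andbT mule_ge0//; first by rewrite lee_fin invr_ge0 ltW.
  by apply: integral_ge0 => t _; rewrite lee_fin powR_ge0.
- by rewrite lee_wpmul2l// lee_fin invr_ge0 ltW.
Qed.

Lemma Mean_EFin_le (p r B : R) (g : C -> C) : 0 < p -> 0 <= B ->
  (\int[leb]_(t in `[0%R, (2 * pi)%R]) (modulus (g (cis r t)) `^ p)%:E <= B%:E)%E ->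
  (Mean p%:E g r <= (((2 * pi)^-1 * B) `^ p^-1)%:E)%E.
Proof.
move=> p0 B0 H; have pi20 : 0 < 2 * pi :> R by rewrite mulr_gt0 ?pi_gt0.
rewrite -poweR_EFin EFinM /Mean; apply: gt0_ler_poweR.
- by rewrite invr_ge0 ltW.
- rewrite in_itv/= leey andbT mule_ge0//; first by rewrite lee_fin invr_ge0 ltW.
  by apply: integral_ge0 => t _; rewrite lee_fin powR_ge0.
- by rewrite in_itv/= leey andbT -EFinM lee_fin !mulr_ge0 ?powR_ge0// invr_ge0 ltW.
- by rewrite lee_wpmul2l// lee_fin invr_ge0 ltW.
Qed.

Lemma integral_circle_le (A q r : R) (g : R -> R) : 0 <= A -> 0 < q -> 0 < r < 1 ->
  measurable_fun setT g -> (forall t, 0 <= g t) ->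
  (forall t, 0 <= t <= 2 * pi -> g t <= A * modulus (1 - cis r t) `^ (- (1 + q))) ->
  (\int[leb]_(t in `[0%R, (2 * pi)%R]) (g t)%:E <=
     (A * 5 `^ (1 + q) * 2 / q * (1 - r) `^ (- q))%:E)%E.
Proof.
move=> A0 q0 r01 mg g0 gA; have r1 := onemr_gt0 r01.
have pi20 : 0 < 2 * pi :> R by rewrite mulr_gt0 ?pi_gt0.
have [I1 I2] := integral_powRN_le r1 q0 pi20.
pose h1 (t : R) := (1 - r + t) `^ (- (1 + q)).
pose h2 (t : R) := (1 - r + (2 * pi - t)) `^ (- (1 + q)).
have A5 : 0 <= A * 5 `^ (1 + q) by rewrite mulr_ge0 ?powR_ge0.
have q10 : 0 < 1 + q by rewrite addr_gt0.
have mh1 : measurable_fun setT (fun t : R => (h1 t)%:E).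
  apply/measurable_EFinP; apply: (measurableT_comp (measurable_powR _)).
  exact: measurable_funD.
have mh2 : measurable_fun setT (fun t : R => (h2 t)%:E).
  apply/measurable_EFinP; apply: (measurableT_comp (measurable_powR _)).
  by apply: measurable_funD => //; exact: measurable_funB.
apply: (@le_trans _ _ (\int[leb]_(t in `[0%R, (2 * pi)%R])
    ((A * 5 `^ (1 + q))%:E * ((h1 t)%:E + (h2 t)%:E)))%E).
  apply: ge0_le_integral => //.
  - by move=> t _; rewrite lee_fin.
  - by apply/measurable_EFinP; exact: measurable_funS mg.
  - apply: measurable_funeM; apply: emeasurable_funD; [exact: measurable_funS mh1|exact: measurable_funS mh2].
  - move=> t; rewrite /= in_itv/= => t0; rewrite -EFinD -EFinM lee_fin.
    apply: le_trans (gA _ t0) _; rewrite -mulrA ler_wpM2l//.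
    exact: modulus_1Bcis_powRN_le.
rewrite ge0_integralZl//; first last.
- by move=> t _; rewrite adde_ge0// lee_fin powR_ge0.
- by apply: emeasurable_funD; [exact: measurable_funS mh1|exact: measurable_funS mh2].
rewrite ge0_integralD//; first last.
- exact: measurable_funS mh2.
- by move=> t _; rewrite lee_fin powR_ge0.
- exact: measurable_funS mh1.
- by move=> t _; rewrite lee_fin powR_ge0.
apply: (@le_trans _ _ ((A * 5 `^ (1 + q))%:E * (((1 - r) `^ (- q) / q)%:E + ((1 - r) `^ (- q) / q)%:E))%E).
  by rewrite lee_wpmul2l ?lee_fin// leeD.
rewrite -EFinD -EFinM lee_fin le_eqVlt; apply/orP; left; apply/eqP.
by field; rewrite gt_eqF.
Qed.

Lemma carleson_Hspace (p s gamma : R) : 1 <= p -> 0 < s -> 0 < gamma ->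
  s = alpha + (1 - p^-1) - gamma ->
  carleson s mu <-> Hspace p%:E gamma f.
Proof.
move=> p1 s0 g0 sE; have p0 : 0 < p by rewrite (lt_le_trans _ p1).
have pi20 : 0 < 2 * pi :> R by rewrite mulr_gt0 ?pi_gt0.
have pV0 : 0 < p^-1 by rewrite invr_gt0.
rewrite (HspaceP _ _ (fracD_analytic (mu := mu) halpha)); split.
  have sb : 0 < s < b by rewrite s0 sE; lra.
  move=> /(fracD_upper halpha sb)[K K0 HK].
  (* With this [q] the exponent [(s - b) p] is [- (1 + q)]; integrating over the circle leaves
     [(1 - r) ^ (- q)], whose p-th root is [(1 - r) ^ (- gamma)]. *)
  pose q := gamma * p; have q0 : 0 < q by rewrite mulr_gt0.
  pose B := K `^ p * 5 `^ (1 + q) * 2 / q.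
  have B0 : 0 <= B by rewrite !mulr_ge0 ?powR_ge0// invr_ge0 ltW.
  exists (((2 * pi)^-1 * B) `^ p^-1) => r r01; have r1 := onemr_gt0 r01.
  have d1 (t : R) : disc (cis r t) by apply: disc_cis; case/andP: r01 => /ltW ->.
  apply: (@le_trans _ _ (((1 - r) `^ gamma)%:E * (((2 * pi)^-1 * (B * (1 - r) `^ (- q))) `^ p^-1)%:E)%E).
    rewrite lee_wpmul2l ?lee_fin ?powR_ge0//; apply: Mean_EFin_le => //.
      by rewrite mulr_ge0 ?powR_ge0.
    apply: integral_circle_le => //.
    - exact: powR_ge0.
    - apply: (measurableT_comp (measurable_powR _)).
      by rewrite fracD_FmuE; exact: measurable_modulus_circle (radius_fracD _ halpha) r01.
    - by move=> t; exact: powR_ge0.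
    move=> t _; have -> : - (1 + q) = (s - b) * p.
      by rewrite sE /q; field; rewrite gt_eqF.
    rewrite powRrM -powRM ?powR_ge0//.
    by apply: ge0_ler_powR; rewrite ?nnegrE ?(ltW p0) ?modulus_ge0 ?mulr_ge0 ?powR_ge0// HK.
  rewrite -EFinM lee_fin mulrA [X in _ * X]powRM ?powR_ge0//; last by rewrite mulr_ge0// invr_ge0 ltW.
  rewrite -powRrM mulrCA -powRD; last by rewrite (gt_eqF r1) implybT.
  have -> : gamma + - q * p^-1 = 0 by rewrite /q; field; rewrite gt_eqF.
  by rewrite powRr0 mulr1.
move=> [M HM]; have [e [k [/andP[e0 e1] k0 Hk]]] := fracD_lower mu halpha.
have c0 : 0 < ((2 * pi)^-1 * e) `^ p^-1 * k by rewrite mulr_gt0// powR_gt0// mulr_gt0// invr_gt0.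
apply: (carleson_of_bound (M := M) c0) => r r01; have r1 := onemr_gt0 r01.
apply: powRN_mul_le => //; rewrite -lee_fin; apply: le_trans (HM r r01).
have e2 : 0 <= e * (1 - r) <= 2 * pi.
  rewrite (mulr_ge0 (ltW e0) (ltW r1))/=; apply: (@le_trans _ _ 1).
    by apply: mulr_ile1 => //; [exact: ltW|exact: ltW|have [? _] := andP r01; lra].
  by have := pi_ge2 R; lra.
have m0 : 0 <= fine (mu `[r, 1[%classic) by rewrite fine_ge0.
have c'0 : 0 <= k * (1 - r) `^ (- b) * fine (mu `[r, 1[%classic).
  by rewrite !mulr_ge0 ?powR_ge0// ltW.
have low := Mean_EFin_ge p0 e2 c'0 r01 (fun theta => Hk r theta r01).
apply: le_trans (lee_wpmul2l _ low); last by rewrite lee_fin powR_ge0.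
rewrite -EFinM lee_fin [(2 * pi)^-1 * (e * _)]mulrA [(_ * (1 - r)) `^ _]powRM ?(ltW r1)//; last by rewrite mulr_ge0 ?(ltW e0)// invr_ge0 ltW.
(* The three exponents come from the weight, the length of the arc and the size of the kernel. *)
have -> : - s = gamma + p^-1 + - b by rewrite sE; ring.
have x0 : (1 - r == 0) = false by rewrite gt_eqF.
rewrite powRD; last by rewrite x0 implybT.
rewrite powRD; last by rewrite x0 implybT.
by rewrite le_eqVlt; apply/orP; left; apply/eqP; ring.
Qed.

End growth_spaces.

Unset Implicit Arguments.
Set Strict Implicit.

Theorem theorem5p2 (R : realType) (p alpha s : R)
    (mu : {finite_measure set (measurableTypeR R) -> \bar R})
    (hp : 1 <= p) (halpha : -1 < alpha) (hs : 0 < s)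
    (hmu : carried_by_unit mu) :
  [/\ (forall gamma : R, 0 < gamma < alpha + (1 - p^-1) ->
         s = alpha + (1 - p^-1) - gamma ->
         carleson s mu <-> Hspace p%:E gamma (fracD alpha (Fmu mu))),
      (forall gamma : R, 0 < gamma < alpha + 1 ->
         s = alpha + 1 - gamma ->
         carleson s mu <-> Agrowth gamma (fracD alpha (Fmu mu))) &
      (forall gamma1 gamma2 : R,
         0 < gamma1 < alpha + (1 - p^-1) ->
         s = alpha + (1 - p^-1) - gamma1 ->
         0 < gamma2 < alpha + 1 ->
         s = alpha + 1 - gamma2 ->
         Hspace p%:E gamma1 (fracD alpha (Fmu mu)) <->
         Agrowth gamma2 (fracD alpha (Fmu mu)))].
Proof.
have H1 (gamma : R) : 0 < gamma < alpha + (1 - p^-1) -> s = alpha + (1 - p^-1) - gamma ->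
    carleson s mu <-> Hspace p%:E gamma (fracD alpha (Fmu mu)).
  by move=> /andP[g0 _] sE; exact: carleson_Hspace.
have H2 (gamma : R) : 0 < gamma < alpha + 1 -> s = alpha + 1 - gamma ->
    carleson s mu <-> Agrowth gamma (fracD alpha (Fmu mu)).
  by move=> /andP[g0 _] sE; exact: carleson_Agrowth.
split=> // g1 g2 g10 s1 g20 s2.
by rewrite -(H1 g1)// -(H2 g2).
Qed.
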